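(* Let $\mathcal{A}=\mathcal{A}(a,b)$ be an arc in $\mathbb{C}_p$. For each $\alpha \in \mathbb{Z}$ the set $\mathcal{I}_{\mathcal{A},\Phi_{\alpha}}$ contains all functions that are uniform limits on $\mathcal{A}$ of rational functions having no poles in $\mathcal{A}$, that is, all Krasner analytic functions on $\mathcal{A}$.
   Context: $p$ is an odd prime; $\mathbb{C}_p$ is the completion of an algebraic closure of $\mathbb{Q}_p$, with $|p|_p=1/p$. Arc: for $a\ne b$ in $\mathbb{C}_p$ with $R=|a-b|_p$, the arc $\mathcal{A}(a,b)$ is the open disc $\{x : |x-b|_p<R\}$. $H(\mathcal{A})$ is the set of functions on $\mathcal{A}$ given by a single power series convergent on $\mathcal{A}$. Path sequence: a function $\varphi$ defined for all integers $k\ge k_0$ (some $k_0\in\mathbb{Z}^+$), with values in $\mathbb{Z}^+$ and strictly increasing. For $f:\mathcal{A}(a,b)\to\mathbb{C}_p$ put $A_{f,\varphi}(k)=p^{-\varphi(k)}\sum_{\zeta}(x-a)f(x)$, where $x=a+(b-a)\zeta$ and $\zeta$ runs through the $p^{\varphi(k)}$-th roots of unity. A non-empty family $\Phi$ of path sequences is interlocked if for all $\varphi_1,\varphi_2\in\Phi$ there are $\varphi_3\in\Phi$ and $k_0$ such that $\varphi_3(k)$, $k\ge k_0$, is a subsequence of both $\varphi_1$ and $\varphi_2$. For interlocked $\Phi$, $\int_{\mathcal{A},\Phi}f(x)\,dx=L$ means: for every $\varepsilon>0$ there are $\varphi_\varepsilon\in\Phi$ and $K_\varepsilon$ with $|A_{f,\varphi_\varepsilon}(k)-L|_p<\varepsilon$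 for all $k>K_\varepsilon$ (such $L$ is unique if it exists). For $\alpha\in\mathbb{Z}$, $\Phi_\alpha$ is the interlocked family $\{\varphi : \varphi(k)=\alpha+\lambda k,\ \lambda=1,2,\dots\}$ (each defined for $k$ large enough that the value is positive). $\mathcal{I}_{\mathcal{A},\Phi}$ is the set of $f\in H(\mathcal{A})$ for which $\int_{\mathcal{A},\Phi}f(x)\,dx$ exists. *)

(* Defs.v *)
From HB Require Import structures.
From mathcomp Require Import all_boot all_order all_algebra.
From mathcomp Require Import zify.
From mathcomp Require Import classical_sets fsbigop reals.

Set Implicit Arguments.
Unset Strict Implicit.
Unset Printing Implicit Defensive.

Import Order.TTheory GRing.Theory Num.Theory.

Local Open Scope classical_set_scope.
Local Open Scope ring_scope.

(** * The valued field C_p *)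

Record nonarch_absval (R : realType) (K : fieldType) (v : K -> R) : Prop := {
  absval_ge0 : forall x, 0 <= v x;
  absval_eq0 : forall x, v x = 0 <-> x = 0;
  absvalM : forall x y, v (x * y) = v x * v y;
  absvalD : forall x y, v (x + y) <= Num.max (v x) (v y) }.

Definition converges (R : realType) (K : fieldType) (v : K -> R)
    (u : nat -> K) (l : K) : Prop :=
  forall e : R, 0 < e ->
    exists N : nat, forall n : nat, (N <= n)%N -> v (u n - l) < e.

Definition cauchy_seq (R : realType) (K : fieldType) (v : K -> R)
    (u : nat -> K) : Prop :=
  forall e : R, 0 < e ->
    exists N : nat, forall m n : nat,
      (N <= m)%N -> (N <= n)%N -> v (u m - u n) < e.

Definition complete_absval (R : realType) (K : fieldType) (v : K -> R) : Prop :=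
  forall u : nat -> K, cauchy_seq v u -> exists l : K, converges v u l.

Definition padic_abs (R : realType) (p : nat) (x : rat) : R :=
  if x == 0 then 0
  else p%:R ^ ((logn p `|denq x|)%:Z - (logn p `|numq x|)%:Z).

Definition is_completion (R : realType) (K L : fieldType)
    (vK : K -> R) (vL : L -> R) (i : {rmorphism K -> L}) : Prop :=
  [/\ nonarch_absval vL,
      forall x, vL (i x) = vK x,
      forall (y : L) (e : R), 0 < e -> exists x : K, vL (y - i x) < e
    & complete_absval vL].

(* [C], with the absolute value [v], is the completion of an algebraic closure
   [Qpbar] of the completion [Qp] of [rat]. This determines [(C, v)] up to
   isometric isomorphism; the normalization |p| = 1/p comes from
   [padic_abs]. *)
Definition is_Cp (R : realType) (p : nat) (C : fieldType) (v : C -> R) : Prop :=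
  exists (Qp : fieldType) (v0 : Qp -> R) (i0 : {rmorphism rat -> Qp})
         (Qpbar : closedFieldType) (v1 : Qpbar -> R)
         (i1 : {rmorphism Qp -> Qpbar}) (i2 : {rmorphism Qpbar -> C}),
  [/\ is_completion (@padic_abs R p) v0 i0,
      forall z : Qpbar, algebraicOver i1 z,
      nonarch_absval v1,
      forall x, v1 (i1 x) = v0 x
    & is_completion v1 v i2].

(** * Functions on an arc

    A function on a subset of [C] is represented by a total function [C -> C];
    only its values on that subset are ever used. *)

Definition Arc (R : realType) (C : fieldType) (v : C -> R) (a b : C) : set C :=
  [set x | v (x - b) < v (a - b)].

(* The power series is centred at the point [b] of the arc. *)
Definition H_arc (R : realType) (C : fieldType) (v : C -> R) (a b : C) :
    set (C -> C) :=
  [set f | exists c : nat -> C, forall x, Arc v a b x ->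
     converges v (fun n => \sum_(i < n) c i * (x - b) ^+ i) (f x)].

(* After cancelling common factors, a rational function has no pole in [A]
   exactly when it is a quotient P / Q with Q without zeros in [A]. *)
Definition rational_without_poles (C : fieldType) (A : set C) : set (C -> C) :=
  [set r | exists P Q : {poly C}, forall x, A x ->
     Q.[x] != 0 /\ r x = P.[x] / Q.[x]].

Definition uniform_limit (R : realType) (C : fieldType) (v : C -> R)
    (A : set C) (r : nat -> C -> C) (f : C -> C) : Prop :=
  forall e : R, 0 < e ->
    exists N : nat, forall n : nat, (N <= n)%N ->
      forall x, A x -> v (r n x - f x) < e.

Definition Krasner_analytic (R : realType) (C : fieldType) (v : C -> R)
    (A : set C) : set (C -> C) :=
  [set f | exists r : nat -> C -> C,
     (forall n, rational_without_poles A (r n)) /\ uniform_limit v A r f].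

(** * Path sequences *)

(* The values of [path_val] below [path_start] are irrelevant. *)
Record path_seq := PathSeq {
  path_start : nat;
  path_val :> nat -> nat;
  path_start_gt0 : (0 < path_start)%N;
  path_val_gt0 : forall k, (path_start <= k)%N -> (0 < path_val k)%N;
  path_val_incr : forall k l, (path_start <= k)%N -> (k < l)%N ->
    (path_val k < path_val l)%N }.

(* phi(k), k >= k0, is a subsequence of psi. *)
Definition tail_subseq (k0 : nat) (phi psi : path_seq) : Prop :=
  exists s : nat -> nat,
    (forall k l, (k0 <= k)%N -> (k < l)%N -> (s k < s l)%N) /\
    (forall k, (k0 <= k)%N -> (path_start psi <= s k)%N /\ phi k = psi (s k)).

Definition interlocked (Phi : set path_seq) : Prop :=
  Phi !=set0 /\
  forall phi1 phi2, Phi phi1 -> Phi phi2 ->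
    exists2 phi3, Phi phi3 &
      exists k0 : nat, [/\ (path_start phi3 <= k0)%N,
        tail_subseq k0 phi3 phi1 & tail_subseq k0 phi3 phi2].

Definition Phi_ (alpha : int) : set path_seq :=
  [set phi | exists2 lambda : nat, (0 < lambda)%N &
     (forall k : nat, (path_start phi <= k)%N =
        (0 < k)%N && (0 < alpha + (lambda * k)%:Z)) /\
     (forall k : nat, (path_start phi <= k)%N ->
        (phi k)%:Z = alpha + (lambda * k)%:Z)].

Lemma Phi_ex (alpha : int) (lambda : nat) : (0 < lambda)%N ->
  exists phi : path_seq,
    (forall k : nat, (path_start phi <= k)%N =
        (0 < k)%N && (0 < alpha + (lambda * k)%:Z)) /\
    (forall k : nat, (path_start phi <= k)%N ->
        (phi k)%:Z = alpha + (lambda * k)%:Z).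
Proof.
move=> l0.
pose P (k : nat) := (0 < k)%N && (0 < alpha + (lambda * k)%:Z).
have exP : exists k, P k.
  by exists (`|alpha|.+1)%N; rewrite /P /=; nia.
pose k0 := ex_minn exP.
have k0P k : (k0 <= k)%N = P k.
  rewrite /k0; case: ex_minnP => m Pm mmin; apply/idP/idP; last exact: mmin.
  by move: Pm; rewrite /P => /andP[m0 am] mk; apply/andP; split; nia.
have h1 : (0 < k0)%N by have := k0P k0; rewrite leqnn => /esym /andP[].
have h2 k : (k0 <= k)%N -> (0 < absz (alpha + (lambda * k)%:Z)%R)%N.
  by rewrite k0P => /andP[_ ?]; lia.
have h3 k l : (k0 <= k)%N -> (k < l)%N ->
    (absz (alpha + (lambda * k)%:Z)%R < absz (alpha + (lambda * l)%:Z)%R)%N.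
  by rewrite k0P => /andP[_ ?] kl; nia.
exists (PathSeq h1 h2 h3); split=> /= k; first exact: k0P.
by rewrite k0P => /andP[_ ?]; lia.
Qed.

Lemma Phi_interlocked (alpha : int) : interlocked (Phi_ alpha).
Proof.
split; first by have [phi phiP] := @Phi_ex alpha 1 isT; exists phi; exists 1%N.
move=> f1 f2 [l1 l10 [s1 v1]] [l2 l20 [s2 v2]].
have l30 : (0 < l1 * l2)%N by rewrite muln_gt0 l10.
have [f3 [s3 v3]] := Phi_ex alpha l30.
exists f3; first by exists (l1 * l2)%N.
exists (path_start f3); split=> //; [exists (muln l2)|exists (muln l1)].
- split=> [k l _ kl|k kge]; first by rewrite ltn_pmul2l.
  have := kge; rewrite s3 => /andP[k0 ak].
  have sk : (path_start f1 <= l2 * k)%N by rewrite s1 muln_gt0 l20 k0 mulnA.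
  by split=> //; have := v1 _ sk; have := v3 _ kge; rewrite mulnA; lia.
- split=> [k l _ kl|k kge]; first by rewrite ltn_pmul2l.
  have := kge; rewrite s3 => /andP[k0 ak].
  have sk : (path_start f2 <= l1 * k)%N.
    by rewrite s2 muln_gt0 l10 k0 mulnA (mulnC l2).
  split=> //; have := v2 _ sk; have := v3 _ kge.
  by rewrite mulnA (mulnC l2); lia.
Qed.

(** * The integral *)

Definition path_mean (p : nat) (C : fieldType) (a b : C) (f : C -> C)
    (phi : path_seq) (k : nat) : C :=
  (p ^ phi k)%:R^-1 *
  \sum_(zeta \in [set z : C | z ^+ (p ^ phi k) = 1])
     (let x := a + (b - a) * zeta in (x - a) * f x).

Definition is_integral (R : realType) (p : nat) (C : fieldType) (v : C -> R)
    (a b : C) (Phi : set path_seq) (f : C -> C) (L : C) : Prop :=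
  forall e : R, 0 < e ->
    exists2 phi, Phi phi &
      exists K : nat, forall k : nat, (path_start phi <= k)%N -> (K < k)%N ->
        v (path_mean p a b f phi k - L) < e.

Definition path_integrable (R : realType) (p : nat) (C : fieldType) (v : C -> R)
    (a b : C) (Phi : set path_seq) : set (C -> C) :=
  [set f | H_arc v a b f /\ exists L : C, is_integral p v a b Phi f L].

(* Main.v *)
(** Put x = a + (b - a) u, so that the arc becomes the disc D : |u - 1| < 1 and
    A_{f,phi}(k) is the mean of (x - a) f(x) over the p^phi(k)-th roots of unity u.

    The factor p^-n in the mean is harmless: the mean of (u - 1)^i is an
    integer, so the mean of a power series in u - 1 is bounded by its
    coefficients, hence (Cauchy's estimate) by its supremum on D. Therefore
    everything is stable under uniform limits, and it is enough to treat a dense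
    class of functions: sums of polynomials and of fractions c / (beta - u) with
    |beta - 1| >= 1. Multiple poles may be moved apart at arbitrarily small cost.

    The mean of 1 / (beta - u) over the N-th roots of unity is
    beta^(N-1) / (beta^N - 1). When |beta| <= 1, the residue of beta is algebraic
    over F_p, so it is fixed by some power x -> x^(p^lambda) of Frobenius, and
    beta^(p^(alpha + lambda k)) converges as k grows because x -> x^p contracts
    residue discs; |beta| > 1 reduces to 1 / beta. *)

Require Import Defs.
From HB Require Import structures.
From mathcomp Require Import all_boot all_order all_algebra all_solvable all_field.
From mathcomp Require Import zify ring lra.
From mathcomp Require Import boolp classical_sets functions.
From mathcomp Require Import fsbigop reals.

Set Implicit Arguments.
Unset Strict Implicit.
Unset Printing Implicit Defensive.

Import Order.TTheory GRing.Theory Num.Theory.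

Local Open Scope classical_set_scope.
Local Open Scope ring_scope.

(** * Non-archimedean absolute values *)

Section Absval.
Variables (R : realType) (K : fieldType) (v : K -> R).
Hypothesis Hv : nonarch_absval v.

Lemma absval0 : v 0 = 0.
Proof. exact/(absval_eq0 Hv). Qed.

Lemma absval_eq0b x : (v x == 0) = (x == 0).
Proof. by apply/eqP/eqP => /(absval_eq0 Hv). Qed.

Lemma absval_gt0 x : (0 < v x) = (x != 0).
Proof. by rewrite lt0r absval_eq0b (absval_ge0 Hv) andbT. Qed.

Lemma absval1 : v 1 = 1.
Proof.
have h : v 1 != 0 by rewrite absval_eq0b oner_neq0.
by apply: (mulfI h); rewrite -(absvalM Hv) !mulr1.
Qed.

Lemma absvalX x n : v (x ^+ n) = v x ^+ n.
Proof.
by elim: n => [|n IH]; rewrite ?expr0 ?absval1 // !exprS (absvalM Hv) IH.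
Qed.

Lemma absvalN1 : v (- 1) = 1.
Proof.
have h : v (-1) ^+ 2 = 1 by rewrite -absvalX sqrrN expr1n absval1.
by apply/eqP; rewrite -(@pexpr_eq1 _ _ 2) ?(absval_ge0 Hv) // h.
Qed.

Lemma absvalN x : v (- x) = v x.
Proof. by rewrite -mulN1r (absvalM Hv) absvalN1 mul1r. Qed.

Lemma absval_distC x y : v (x - y) = v (y - x).
Proof. by rewrite -absvalN opprB. Qed.

Lemma absvalV x : v x^-1 = (v x)^-1.
Proof.
have [->|x0] := eqVneq x 0; first by rewrite invr0 absval0 invr0.
have h : v x != 0 by rewrite absval_eq0b.
by apply: (mulfI h); rewrite -(absvalM Hv) !divff // absval1.
Qed.

Lemma absval_add_le x y M : v x <= M -> v y <= M -> v (x + y) <= M.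
Proof.
by move=> hx hy; apply: (le_trans (absvalD Hv x y)); rewrite ge_max hx hy.
Qed.

Lemma absval_add_lt x y M : v x < M -> v y < M -> v (x + y) < M.
Proof.
by move=> hx hy; apply: (le_lt_trans (absvalD Hv x y)); rewrite gt_max hx hy.
Qed.

Lemma absval_sub_le x y M : v x <= M -> v y <= M -> v (x - y) <= M.
Proof. by move=> hx hy; apply: absval_add_le; rewrite ?absvalN. Qed.

Lemma absval_sub_lt x y M : v x < M -> v y < M -> v (x - y) < M.
Proof. by move=> hx hy; apply: absval_add_lt; rewrite ?absvalN. Qed.

Lemma absval_dist_le y x z M : v (x - y) <= M -> v (y - z) <= M -> v (x - z) <= M.
Proof. by move=> h1 h2; rewrite -(subrKA y); apply: absval_add_le. Qed.

Lemma absval_dist_lt y x z M : v (x - y) < M -> v (y - z) < M -> v (x - z) < M.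
Proof. by move=> h1 h2; rewrite -(subrKA y); apply: absval_add_lt. Qed.

Lemma absval_sum_le (I : Type) (r : seq I) (P : pred I) (F : I -> K) M :
  0 <= M -> (forall i, P i -> v (F i) <= M) -> v (\sum_(i <- r | P i) F i) <= M.
Proof.
move=> M0 h; elim/big_rec: _ => [|i x Pi hx]; first by rewrite absval0.
by apply: absval_add_le => //; apply: h.
Qed.

Lemma absval_sum_lt (I : Type) (r : seq I) (P : pred I) (F : I -> K) M :
  0 < M -> (forall i, P i -> v (F i) < M) -> v (\sum_(i <- r | P i) F i) < M.
Proof.
move=> M0 h; elim/big_rec: _ => [|i x Pi hx]; first by rewrite absval0.
by apply: absval_add_lt => //; apply: h.
Qed.

Lemma absval_prod (I : Type) (r : seq I) (F : I -> K) :
  v (\prod_(i <- r) F i) = \prod_(i <- r) v (F i).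
Proof.
by elim/big_ind2: _ => [|x x' y y' <- <-|//]; rewrite ?absval1 ?(absvalM Hv).
Qed.

Lemma absval_nat_le1 n : v n%:R <= 1.
Proof.
elim: n => [|n IH]; first by rewrite absval0.
by rewrite -natr1; apply: absval_add_le; rewrite ?absval1.
Qed.

Lemma absval_int_le1 (z : int) : v z%:~R <= 1.
Proof.
by case: z => n; rewrite ?NegzE ?mulrNz ?absvalN; apply: absval_nat_le1.
Qed.

Lemma absval_ge1_perturb x y : v (x - y) < 1 -> 1 <= v x -> 1 <= v y.
Proof.
move=> h hx; rewrite leNgt; apply/negP => hy.
by have := absval_add_lt h hy; rewrite subrK ltNge hx.
Qed.

(** Otherwise a late term would be closer to [l] than [v (l - x)], and the ultrametric inequality
    would give [v (l - x) < v (l - x)]. *)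
Lemma converges_le (s : nat -> K) l x M N :
  converges v s l -> (forall n, (N <= n)%N -> v (s n - x) <= M) -> v (l - x) <= M.
Proof.
move=> h hs; rewrite leNgt; apply/negP => hM.
have d0 : 0 < v (l - x).
  by apply: le_lt_trans hM; apply: (le_trans (absval_ge0 Hv _) (hs N (leqnn _))).
have [N' hN'] := h _ d0.
have h1 := hN' (maxn N N') (leq_maxr _ _).
have h2 := hs (maxn N N') (leq_maxl _ _).
have h3 := le_lt_trans h2 hM.
rewrite absval_distC in h1.
by have := absval_dist_lt h1 h3; rewrite ltxx.
Qed.

Lemma converges_absval_le (s : nat -> K) l M N :
  converges v s l -> (forall n, (N <= n)%N -> v (s n) <= M) -> v l <= M.
Proof.
move=> h hs; rewrite -[l]subr0; apply: (converges_le (N := N)) h _ => n hn.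
by rewrite subr0; apply: hs.
Qed.

Lemma convergesD (s t : nat -> K) l l' :
  converges v s l -> converges v t l' ->
  converges v (fun n => s n + t n) (l + l').
Proof.
move=> h h' e e0; have [N hN] := h _ e0; have [N' hN'] := h' _ e0.
exists (maxn N N') => n; rewrite geq_max => /andP[n1 n2].
by rewrite opprD addrACA; apply: absval_add_lt; [apply: hN|apply: hN'].
Qed.

Lemma convergesZ (s : nat -> K) l c :
  converges v s l -> converges v (fun n => c * s n) (c * l).
Proof.
move=> h; have [->|c0] := eqVneq c 0.
  by move=> e e0; exists 0 => n _; rewrite !mul0r subr0 absval0.
have vc0 : 0 < v c by rewrite absval_gt0.
move=> e e0; have [N hN] := h (e / v c) (divr_gt0 e0 vc0).
exists N => n /hN; rewrite -mulrBr (absvalM Hv).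
by rewrite ltr_pdivlMr // mulrC.
Qed.

Lemma converges_sum (I : Type) (r : seq I) (s : I -> nat -> K) (l : I -> K) :
  (forall i, converges v (s i) (l i)) ->
  converges v (fun n => \sum_(i <- r) s i n) (\sum_(i <- r) l i).
Proof.
move=> h; elim: r => [|i r IH].
  by move=> e e0; exists 0 => n _; rewrite !big_nil subr0 absval0.
rewrite big_cons; have := convergesD (h i) IH.
by congr (converges v _ _); apply/funext => n; rewrite big_cons.
Qed.

End Absval.

(** * Real sequences tending to zero *)

Section RealSequences.
Variable R : realType.

Lemma exp_small (x e : R) : 0 <= x < 1 -> 0 < e ->
  exists N : nat, forall n, (N <= n)%N -> x ^+ n < e.
Proof.
move=> /andP[x0 x1] e0.
have [->|xn0] := eqVneq x 0.
  exists 1%N => -[//|n] _; by rewrite expr0n.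
have xp : 0 < x by rewrite lt0r xn0.
have d0 : 0 < x^-1 - 1 by rewrite subr_gt0 invf_gt1.
(* Bernoulli's inequality for [x^-1 > 1]: the inverse powers grow at least linearly in [n]. *)
have bern n : 1 + n%:R * (x^-1 - 1) <= x^-1 ^+ n.
  elim: n => [|n IH]; first by rewrite mul0r addr0 expr0.
  rewrite exprS; apply: (@le_trans _ _ (x^-1 * (1 + n%:R * (x^-1 - 1)))); last first.
    by rewrite ler_pM2l ?invr_gt0.
  have := ler0n R n; rewrite -natr1; move: d0 n%:R; set y := x^-1; move=> d0 z z0.
  by have := mulr_ge0 z0 (sqr_ge0 (y - 1)); nra.
pose N := Num.bound (e^-1 / (x^-1 - 1)).
exists N => n Nn.
have hN : e^-1 < N%:R * (x^-1 - 1).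
  rewrite -ltr_pdivrMr //; apply: archi_boundP.
  by rewrite divr_ge0 // ?invr_ge0 ltW.
rewrite -[x ^+ n]invrK -[e]invrK ltf_pV2 ?posrE ?invr_gt0 ?exprn_gt0 //.
rewrite -exprVn; apply: (lt_le_trans hN); apply: le_trans (bern n).
apply: (@le_trans _ _ (n%:R * (x^-1 - 1))); last by rewrite lerDr.
by rewrite ler_pM2r // ler_nat.
Qed.

Lemma invn_small (e : R) : 0 < e ->
  exists N : nat, forall n, (N <= n)%N -> n.+1%:R^-1 < e.
Proof.
move=> e0; exists (Num.bound e^-1) => n hn.
rewrite -[e]invrK ltf_pV2 ?posrE ?invr_gt0 // ?ltr0Sn //.
have h := @archi_boundP R e^-1 (ltW _).
apply: lt_le_trans (h _) _; first by rewrite invr_gt0.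
by rewrite ler_nat ltnW.
Qed.

End RealSequences.

(** * The completion of an algebraically closed field is algebraically closed *)

Section PolyAbsval.
Variables (R : realType) (K : fieldType) (v : K -> R).
Hypothesis Hv : nonarch_absval v.

(** The bound is kept at least 1 so that its powers increase with the exponent in later
    estimates. *)
Lemma poly_coef_bounded (q : {poly K}) :
  exists2 B : R, 1 <= B & forall j, v q`_j <= B.
Proof.
exists (1 + \sum_(j < size q) v q`_j).
  by rewrite lerDl sumr_ge0 // => j _; apply: (absval_ge0 Hv).
move=> j; have [jq|qj] := ltnP j (size q); last first.
  rewrite nth_default // absval0 // addr_ge0 // sumr_ge0 // => k _.
  exact: (absval_ge0 Hv).
rewrite (bigD1 (Ordinal jq)) //= addrCA lerDl addr_ge0 // sumr_ge0 // => k _.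
exact: (absval_ge0 Hv).
Qed.

Lemma absval_horner_le (q : {poly K}) x B M d :
  1 <= B -> v x <= B -> (forall j, v q`_j <= M) -> (size q <= d.+1)%N ->
  v q.[x] <= M * B ^+ d.
Proof.
move=> B1 xB qM qd.
have M0 : 0 <= M by apply: le_trans (qM 0); apply: (absval_ge0 Hv).
have B0 : 0 <= B by apply: le_trans B1.
rewrite horner_coef; apply: (absval_sum_le Hv) => [|j _].
  by rewrite mulr_ge0 ?exprn_ge0.
rewrite (absvalM Hv) (absvalX Hv) ler_pM ?exprn_ge0 ?(absval_ge0 Hv) //.
apply: (@le_trans _ _ (B ^+ j)).
  by rewrite lerXn2r ?nnegrE ?(absval_ge0 Hv).
by rewrite ler_weXn2l // -ltnS (leq_trans (ltn_ord j)).
Qed.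

(** If [v x > B], the leading term strictly dominates all the others and the value cannot vanish. *)
Lemma absval_root_le (q : {poly K}) x B :
  1 <= B -> q \is monic -> (forall j, v q`_j <= B) -> root q x -> v x <= B.
Proof.
move=> B1 qm qB /rootP qx; rewrite leNgt; apply/negP => Bx.
have B0 : 0 < B by apply: lt_le_trans B1.
have x0 : 0 < v x by apply: lt_trans Bx.
have x1 : 1 < v x by apply: le_lt_trans Bx.
case Hd : (size q) => [|d].
  by have := monic_neq0 qm; rewrite -size_poly_eq0 Hd.
have qd : q`_d = 1 by move/monicP: qm; rewrite lead_coefE Hd.
move: qx; rewrite horner_coef Hd big_ord_recr /= qd mul1r.
move/eqP; rewrite addr_eq0 => /eqP h.
have : v (\sum_(i < d) q`_i * x ^+ i) < v x ^+ d.
  apply: (absval_sum_lt Hv) => [|j _]; first by rewrite exprn_gt0.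
  rewrite (absvalM Hv) (absvalX Hv).
  apply: (@lt_le_trans _ _ (v x * v x ^+ j)).
    rewrite ltr_pM2r ?exprn_gt0 //; exact: le_lt_trans (qB _) Bx.
  by rewrite -exprS ler_weXn2l // ltW.
by rewrite h (absvalN Hv) (absvalX Hv) ltxx.
Qed.

Lemma cauchy_of_steps (s : nat -> K) :
  (forall e, 0 < e -> exists N, forall n, (N <= n)%N -> v (s n - s n.+1) < e) ->
  cauchy_seq v s.
Proof.
move=> h e e0; have [N hN] := h e e0; exists N.
have hs m : (N <= m)%N -> v (s m - s N) < e.
  elim: m => [|m IH]; first by rewrite leqn0 => /eqP ->; rewrite subrr absval0.
  rewrite leq_eqVlt => /orP[/eqP <-|]; first by rewrite subrr absval0.
  move=> Nm; apply: (absval_dist_lt Hv (y := s m)); last exact: IH.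
  by rewrite (absval_distC Hv); apply: hN.
move=> m n Nm Nn; apply: (absval_dist_lt Hv (y := s N)); first exact: hs.
by rewrite (absval_distC Hv); apply: hs.
Qed.

End PolyAbsval.

(** Take [z] where [f] is minimal. With [f z] the distance from a point to a root [z], a small value
    of a monic polynomial forces a root nearby. *)
Lemma exp_size_le_prod (R : realType) (T : eqType) (s : seq T) (f : T -> R) :
  (forall z, 0 <= f z) -> (0 < size s)%N ->
  exists2 z, z \in s & f z ^+ size s <= \prod_(y <- s) f y.
Proof.
move=> f0 s0.
have [z zs hz] : exists2 z, z \in s & forall y, y \in s -> f z <= f y.
  elim: s s0 => // x [|y s] IH _.
    by exists x; rewrite ?mem_head // => y; rewrite inE => /eqP ->.
  have [z zs hz] := IH isT.
  have [xz|zx] := leP (f x) (f z).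
    exists x; rewrite ?mem_head // => t; rewrite inE => /predU1P[-> //|ts].
    exact: le_trans xz (hz _ ts).
  exists z; first by rewrite inE zs orbT.
  by move=> t; rewrite inE => /predU1P[->|/hz //]; apply: ltW.
exists z => //; elim: s {s0 zs} hz => [|y s IH] hz.
  by rewrite big_nil expr0.
rewrite big_cons exprS ler_pM ?exprn_ge0 ?hz ?mem_head // IH // => t ts.
by rewrite hz // inE ts orbT.
Qed.

Section CompletionClosed.
Variables (R : realType) (F : closedFieldType) (K : fieldType).
Variables (w : F -> R) (v : K -> R) (i : {rmorphism F -> K}).
Hypothesis Fc : is_completion w v i.

Let Hv : nonarch_absval v. Proof. by case: Fc. Qed.

(** Density is used only below the leading coefficient; the leading 1 is kept, so the degree does
    not change. *)
Lemma monic_approx (q : {poly K}) (e : R) : q \is monic -> 0 < e ->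
  exists q' : {poly F}, [/\ q' \is monic, size q' = size q
    & forall j, v (q`_j - i q'`_j) < e].
Proof.
case: Fc => _ _ dense _ qm e0.
have [Y hY] := choice (fun x => dense x e e0).
case Hd : (size q) => [|d].
  by have := monic_neq0 qm; rewrite -size_poly_eq0 Hd.
have qd : q`_d = 1 by move/monicP: qm; rewrite lead_coefE Hd.
pose g := \poly_(j < d) Y q`_j.
have sg : (size g < size ('X^d : {poly F})%R)%N by rewrite size_polyXn ltnS size_poly.
exists ('X^d + g); split.
- by rewrite monicE lead_coefDl // lead_coefXn.
- by rewrite size_polyDl // size_polyXn.
move=> j; rewrite coefD coefXn coef_poly.
have [jd|jd|->] := ltngtP j d.
- by rewrite add0r.
- by rewrite add0r rmorph0 subr0 nth_default ?Hd // absval0.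
- by rewrite addr0 rmorph1 qd subrr absval0.
Qed.

(* If q' is close to q and q(r) is small, then q'(r) is small too; |q'(r)| is the
   product of the distances from r to the roots of q', so one root is close to r. *)
Lemma approx_root_step (q : {poly K}) (B : R) (d : nat) :
  q \is monic -> size q = d.+2 -> 1 <= B -> (forall j, v q`_j <= B) ->
  forall (r : K) (D e : R), v r <= B -> v q.[r] <= D -> 0 < e -> e <= D ->
  exists r' : K, [/\ v r' <= B, v q.[r'] <= e & v (r - r') ^+ d.+1 <= D].
Proof.
move=> qm qd B1 qB r D e rB rD e0 eD.
have B0 : 0 < B by apply: lt_le_trans B1.
have Bd : 0 < B ^+ d.+1 by rewrite exprn_gt0.
(* The bound [e / B ^+ d.+1] keeps the values of the two polynomials within [e] on the ball of
   radius [B]; the cap at 1 keeps the coefficients of [Q] bounded by [B]. *)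
pose e1 := Num.min 1 (e / B ^+ d.+1).
have e10 : 0 < e1 by rewrite lt_min ltr01 divr_gt0.
have [q' [q'm q's q'q]] := monic_approx qm e10.
pose Q := map_poly i q'.
have Qm : Q \is monic by rewrite monic_map.
have Qq j : v (q`_j - Q`_j) < e1 by rewrite coef_map.
have QB j : v Q`_j <= B.
  rewrite -[Q`_j](subKr q`_j); apply: (absval_sub_le Hv) => //.
  by apply: le_trans (ltW (Qq j)) _; rewrite ge_min B1.
have dist x : v x <= B -> v (q.[x] - Q.[x]) <= e.
  move=> xB; rewrite -hornerN -hornerD.
  have /(_ e1 d.+1) := absval_horner_le Hv B1 xB (q := q - Q).
  move=> /(_ _ _)/le_trans; apply => [j||].
  - by rewrite coefB; apply: ltW.
  - by rewrite (leq_trans (size_polyD _ _)) // size_polyN size_map_poly q's qd maxnn.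
  - by rewrite -ler_pdivlMr // ge_min lexx orbT.
have [s hs] := closed_field_poly_normal q'.
have {}hs : q' = \prod_(z <- s) ('X - z%:P).
  by rewrite {1}hs (monicP q'm) scale1r.
have ss : size s = d.+1.
  by have := q's; rewrite hs size_prod_XsubC qd => -[].
have Qe : Q = \prod_(z <- s) ('X - (i z)%:P).
  rewrite /Q hs rmorph_prod; apply: eq_bigr => z _.
  by rewrite rmorphB /= map_polyX map_polyC.
have rQ : v Q.[r] <= D.
  rewrite -[Q.[r]](subKr q.[r]); apply: (absval_sub_le Hv) => //.
  exact: le_trans (dist _ rB) eD.
have [z zs hz] : exists2 z, z \in s & v (r - i z) ^+ d.+1 <= D.
  have [z zs hz] := exp_size_le_prod (s := s) (f := fun z => v (r - i z))
    (fun z => absval_ge0 Hv _) ltac:(by rewrite ss).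
  exists z => //; rewrite -ss (le_trans hz) //.
  rewrite Qe horner_prod (absval_prod Hv) in rQ.
  by under eq_bigr => y _ do rewrite -[r - _]hornerXsubC.
exists (i z).
have zr : root Q (i z).
  by rewrite Qe -(big_map i xpredT (fun y => 'X - y%:P)) root_prod_XsubC map_f.
have zB : v (i z) <= B := absval_root_le Hv B1 Qm QB zr.
split=> //; have := dist _ zB.
by rewrite (rootP zr) subr0.
Qed.

(** Approximate roots with values at most [B / n.+1] can be chosen with steps tending to 0. They
    form a Cauchy sequence, and [q] vanishes at its limit. *)
Lemma completion_monic_root (q : {poly K}) (d : nat) :
  q \is monic -> size q = d.+2 -> exists x, root q x.
Proof.
move=> qm qd; have [B B1 qB] := poly_coef_bounded Hv q.
have B0 : 0 < B by apply: lt_le_trans B1.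
pose D n : R := B / n.+1%:R.
have D0 n : 0 < D n by rewrite divr_gt0 // ltr0Sn.
have DS n : D n.+1 <= D n.
  by rewrite ler_pM2l // lef_pV2 ?posrE ?ltr0Sn // ler_nat.
pose Good n r := v r <= B /\ v q.[r] <= D n.
(* The premise [Good] sits under the existential, so that [choice] yields a total step function. *)
have step (nr : nat * K) : exists r' : K, Good nr.1 nr.2 ->
    Good nr.1.+1 r' /\ v (nr.2 - r') ^+ d.+1 <= D nr.1.
  case: nr => n r /=; have [[rB rD]|h] := pselect (Good n r); last by exists r.
  have [r' [h1 h2 h3]] := approx_root_step qm qd B1 qB rB rD (D0 n.+1) (DS n).
  by exists r'.
have [f hf] := choice step.
pose fix s n := if n is n'.+1 then f (n', s n') else 0.
(* The start 0 is good because [q.[0]] is the constant coefficient and [D 0 = B]. *)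
have sG n : Good n (s n).
  elim: n => [|n IH]; last by have [] := hf (n, s n) IH.
  split; first by rewrite absval0 // ltW.
  by rewrite horner_coef0 /D divr1.
have sS n : v (s n - s n.+1) ^+ d.+1 <= D n by have [] := hf (n, s n) (sG n).
have Dsmall e : 0 < e -> exists N, forall n, (N <= n)%N -> D n < e.
  move=> e0; have [N hN] := invn_small (divr_gt0 e0 B0).
  by exists N => n /hN; rewrite ltr_pdivlMr // mulrC.
have sC : cauchy_seq v s.
  apply: (cauchy_of_steps Hv) => e e0.
  have [N hN] := Dsmall (e ^+ d.+1) (exprn_gt0 _ e0).
  exists N => n /hN h; have := le_lt_trans (sS n) h.
  by rewrite ltr_pXn2r ?nnegrE ?(absval_ge0 Hv) ?(ltW e0).
have [l hl] : exists l, converges v s l by case: Fc => _ _ _; apply.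
exists l.
(* The quotient of [q - q.[l]] by [X - l] is bounded on the ball of radius [B], so [q.[s n]] tends
   to [q.[l]]. *)
have [S hS] : exists S, q - q.[l]%:P = S * ('X - l%:P).
  by apply/factor_theorem; rewrite /root hornerD hornerN hornerC subrr.
have [M M1 SM] := poly_coef_bounded Hv S.
have Hd n : v (q.[s n] - q.[l]) <= M * B ^+ (size S) * v (s n - l).
  have -> : q.[s n] - q.[l] = S.[s n] * (s n - l).
    by rewrite -(hornerXsubC l) -hornerM -hS hornerD hornerN hornerC.
  rewrite (absvalM Hv) ler_wpM2r ?(absval_ge0 Hv) //.
  by apply: (absval_horner_le Hv) => //; case: (sG n).
have C0 : 0 < M * B ^+ (size S).
  by rewrite mulr_gt0 ?exprn_gt0 // (lt_le_trans ltr01).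
rewrite /root -(absval_eq0b Hv) eq_le (absval_ge0 Hv) andbT leNgt.
apply/negP => e0.
have [N hN] := Dsmall _ e0.
have [N' hN'] := hl _ (divr_gt0 e0 C0).
have := hN (maxn N N') (leq_maxl _ _).
have := hN' (maxn N N') (leq_maxr _ _).
move: (maxn N N') => n h1 h2.
have h3 : v q.[s n] < v q.[l] by apply: le_lt_trans h2; case: (sG n).
have h4 : v (q.[s n] - q.[l]) < v q.[l].
  by apply: (le_lt_trans (Hd n)); rewrite mulrC -ltr_pdivlMr.
by have := absval_sub_lt Hv h3 h4; rewrite subKr ltxx.
Qed.

Lemma completion_root (q : {poly K}) : size q != 1 -> exists x, root q x.
Proof.
have [->|q0] := eqVneq q 0; first by exists 0; rewrite root0.
case Hd : (size q) => [|[|d]] // _.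
  by move/eqP: Hd; rewrite size_poly_eq0 (negPf q0).
have c0 : (lead_coef q)^-1 != 0 by rewrite invr_eq0 lead_coef_eq0.
have [|//|x] := @completion_monic_root ((lead_coef q)^-1 *: q) d.
- by rewrite monicE lead_coefZ mulVf // lead_coef_eq0.
- by rewrite size_scale.
by exists x; rewrite -(rootZ _ _ c0).
Qed.

End CompletionClosed.

(** * Frobenius and the residue field *)

Section ResidueChar.
Variables (R : realType) (K : fieldType) (v : K -> R) (p : nat).
Hypotheses (Hv : nonarch_absval v) (p_prime : prime p) (vp : v p%:R < 1).

Lemma absval_natM_lt1 m : (p %| m)%N -> v m%:R < 1.
Proof.
move=> /dvdnP[k ->]; rewrite natrM (absvalM Hv).
apply: le_lt_trans vp; apply: ler_piMl; first exact: (absval_ge0 Hv).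
exact: absval_nat_le1.
Qed.

Lemma absval_intM_lt1 (m : int) : (p %| m)%Z -> v m%:~R < 1.
Proof.
by case: m => m /=; rewrite ?NegzE ?mulrNz ?absvalN //; exact: absval_natM_lt1.
Qed.

(** If [v m%:R < 1], a Bezout relation between [p] and [m] would give [v 1 < 1]. *)
Lemma absval_nat_coprime m : ~~ (p %| m)%N -> v m%:R = 1.
Proof.
move=> pm; apply/eqP; rewrite eq_le absval_nat_le1 // leNgt; apply/negP => h.
have cop : coprimez p%:Z m%:Z by rewrite coprimezE /= prime_coprime.
have [[x y] /= e] := coprimezP _ _ cop.
have : v (x * p%:Z + y * m%:Z)%:~R < 1.
  rewrite intrD !intrM; apply: (absval_add_lt Hv); rewrite (absvalM Hv).
    by apply: le_lt_trans vp; rewrite ler_piMl ?(absval_ge0 Hv) // absval_int_le1.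
  by apply: le_lt_trans h; rewrite ler_piMl ?(absval_ge0 Hv) // absval_int_le1.
by rewrite e (absval1 Hv) ltxx.
Qed.

Lemma absval_int_coprime (m : int) : ~~ (p %| m)%Z -> v m%:~R = 1.
Proof.
by case: m => m /=; rewrite ?NegzE ?mulrNz ?absvalN //; exact: absval_nat_coprime.
Qed.

Lemma absval_subX_le x y n : v x <= 1 -> v y <= 1 ->
  v (x ^+ n - y ^+ n) <= v (x - y).
Proof.
move=> x1 y1; rewrite subrXX (absvalM Hv) ler_piMr ?(absval_ge0 Hv) //.
apply: (absval_sum_le Hv) => // i _.
by rewrite (absvalM Hv) !(absvalX Hv) mulr_ile1 ?exprn_ge0 ?exprn_ile1 ?(absval_ge0 Hv).
Qed.

(** With [x = y + d], every term of [(y + d)^p] other than the two extreme ones has a binomial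
    coefficient divisible by [p] and at least one factor [d]. *)
Lemma absval_frobenius_add x y : v x <= 1 -> v y <= 1 ->
  v (x ^+ p - y ^+ p - (x - y) ^+ p) <= v p%:R * v (x - y).
Proof.
move=> x1 y1; set d := x - y.
have d1 : v d <= 1 by apply: (absval_sub_le Hv).
have -> : x = y + d by rewrite /d addrC subrK.
case: p p_prime => // p' pp; rewrite exprDn big_ord_recr big_ord_recl /=.
rewrite subnn subn0 !expr0 bin0 binn !mulr1 mul1r !mulr1n.
rewrite -addrA -addrA [X in v X](_ : _ =
  \sum_(i < p') (y ^+ (p'.+1 - bump 0 i) * d ^+ bump 0 i) *+ 'C(p'.+1, bump 0 i));
  last by ring.
apply: (absval_sum_le Hv) => [|i _]; first by rewrite mulr_ge0 ?(absval_ge0 Hv).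
rewrite /bump add1n.
have /dvdnP[k ->] := prime_dvd_bin pp (k := i.+1) (ltn_ord i : (0 < i.+1 < p'.+1)%N).
rewrite -mulr_natl natrM (absvalM Hv) [v (_ * p'.+1%:R)](absvalM Hv).
rewrite exprS mulrCA [v (d * _)](absvalM Hv) mulrA -[leRHS]mulr1.
rewrite ler_pM ?mulr_ge0 ?(absval_ge0 Hv) //.
  rewrite ler_wpM2r ?(absval_ge0 Hv) // ler_piMl ?(absval_ge0 Hv) //.
  exact: absval_nat_le1.
by rewrite (absvalM Hv) !(absvalX Hv) mulr_ile1 ?exprn_ge0 ?exprn_ile1 ?(absval_ge0 Hv).
Qed.

(** Frobenius is injective on the residue field: [(x - y)^p] differs from [x^p - y^p] by less than
    1. *)
Lemma absval_frobenius_inj x y n : v x <= 1 -> v y <= 1 ->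
  v (x ^+ (p ^ n) - y ^+ (p ^ n)) < 1 -> v (x - y) < 1.
Proof.
elim: n x y => [|n IH] x y x1 y1; first by rewrite expn0 !expr1.
rewrite expnS !exprM => /IH h.
have {}h : v (x ^+ p - y ^+ p) < 1.
  by apply: h; rewrite (absvalX Hv) exprn_ile1 ?(absval_ge0 Hv).
have hf := absval_frobenius_add x1 y1.
have hd : v ((x - y) ^+ p) < 1.
  rewrite -[_ ^+ p](subKr (x ^+ p - y ^+ p)); apply: (absval_sub_lt Hv) => //.
  apply: (le_lt_trans hf); apply: le_lt_trans vp.
  by rewrite ler_piMr ?(absval_ge0 Hv) // (absval_sub_le Hv).
by rewrite (absvalX Hv) expr_lt1 ?(absval_ge0 Hv) ?prime_gt0 in hd.
Qed.

(** Each [p]-th power multiplies the distance by at most the larger of the current distance and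
    [v p%:R]. *)
Lemma absval_frobenius_contract x y n : v x <= 1 -> v y <= 1 ->
  v (x ^+ (p ^ n) - y ^+ (p ^ n)) <= Num.max (v (x - y)) (v p%:R) ^+ n * v (x - y).
Proof.
elim: n x y => [|n IH] x y x1 y1; first by rewrite expn0 !expr1 expr0 mul1r.
set t := Num.max _ _.
have h : v (x ^+ p - y ^+ p) <= t * v (x - y).
  rewrite -[_ - _](subrK ((x - y) ^+ p)); apply: (absval_add_le Hv).
    apply: (le_trans (absval_frobenius_add x1 y1)).
    by rewrite ler_wpM2r ?(absval_ge0 Hv) // le_max lexx orbT.
  rewrite (absvalX Hv); case: p p_prime => [|[|q]] // _.
  rewrite exprS ler_pM ?exprn_ge0 ?(absval_ge0 Hv) //.
    by rewrite le_max lexx.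
  by rewrite exprS ler_piMr ?exprn_ile1 ?(absval_ge0 Hv) ?(absval_sub_le Hv).
have t0 : 0 <= t by rewrite le_max (absval_ge0 Hv).
rewrite expnS !exprM.
have /(_ _ _)/le_trans := IH (x ^+ p) (y ^+ p); apply.
- by rewrite (absvalX Hv) exprn_ile1 ?(absval_ge0 Hv).
- by rewrite (absvalX Hv) exprn_ile1 ?(absval_ge0 Hv).
(* The contraction factor does not increase from one power to the next, so [t] serves throughout. *)
have ht : Num.max (v (x ^+ p - y ^+ p)) (v p%:R) <= t.
  by rewrite ge_max !le_max lexx orbT andbT absval_subX_le.
have t'0 : 0 <= Num.max (v (x ^+ p - y ^+ p)) (v p%:R).
  by rewrite le_max (absval_ge0 Hv).
rewrite exprSr -mulrA ler_pM ?exprn_ge0 ?(absval_ge0 Hv) //.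
by rewrite lerXn2r ?nnegrE.
Qed.

Lemma absval_horner_lt1 (q : {poly K}) x :
  v x <= 1 -> (forall j, v q`_j < 1) -> v q.[x] < 1.
Proof.
move=> x1 q1; rewrite horner_coef; apply: (absval_sum_lt Hv) => // j _.
rewrite (absvalM Hv) (absvalX Hv); apply: le_lt_trans (q1 j).
by rewrite ler_piMr ?exprn_ile1 ?(absval_ge0 Hv).
Qed.

(* Pigeonhole: modulo h and p, the powers of X take finitely many values. *)
Lemma integral_mod_period (h : {poly int}) z : h \is monic -> v z <= 1 ->
  v (map_poly intr h).[z] < 1 ->
  exists2 l : nat, (0 < l)%N & v (z ^+ (p ^ l) - z) < 1.
Proof.
move=> hm z1 hz.
(* As [h] is monic, division with remainder works over the integers. *)
pose r k := Pdiv.Ring.rmodp ('X^(p ^ k) : {poly int}) h.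
pose T := {ffun 'I_(size h) -> 'F_p}.
pose key (k : 'I_#|T|.+1) : T := [ffun i : 'I_(size h) => ((r k)`_i)%:~R].
(* There is one more exponent than there are keys, so two remainders agree modulo [p]. *)
have /injectivePn[k [l kl keq]] : ~~ injectiveb key.
  apply/injectiveP => /leq_card; rewrite card_ord ltnn //.
wlog {kl} kl : k l keq / (k < l)%N.
  move=> hw; have [] := ltngtP k l => [||/val_inj e]; first exact: hw.
    by apply: hw.
  by rewrite e eqxx in kl.
have sr m : (size (r m) < size h)%N.
  by rewrite Pdiv.Ring.ltn_rmodp monic_neq0.
have rkl j : (p %| ((r k)`_j - (r l)`_j)%R)%Z.
  have [jh|hj] := ltnP j (size h); last first.
    by rewrite !nth_default ?subrr ?dvdz0 ?(leq_trans (ltnW (sr _))).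
  have := congr1 (fun f : T => f (Ordinal jh)) keq; rewrite !ffunE /= => /eqP.
  rewrite -subr_eq0 -intrB (dvdz_pcharf (pchar_Fp p_prime)) //.
have ev m : exists2 y, v y < 1 & z ^+ (p ^ m) = y + (map_poly intr (r m)).[z].
  have /(congr1 (fun f : {poly int} => (map_poly intr f).[z])) :=
    Pdiv.RingMonic.rdivp_eq hm ('X^(p ^ m)).
  rewrite rmorphXn /= map_polyX hornerXn => ->.
  rewrite rmorphD rmorphM /= hornerD hornerM.
  eexists; last by [].
  rewrite (absvalM Hv); apply: le_lt_trans hz.
  rewrite ler_piMl ?(absval_ge0 Hv) //.
  have := @absval_horner_le _ _ _ Hv
    (map_poly intr (Pdiv.Ring.rdivp ('X^(p ^ m)) h)) z 1 1 _ (lexx _) z1.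
  move=> /(_ _ _ (leqnSn _)); rewrite expr1n mulr1; apply => j.
  by rewrite coef_map absval_int_le1.
have {ev} d : v (z ^+ (p ^ k) - z ^+ (p ^ l)) < 1.
  have [y y1 ->] := ev k; have [y' y'1 ->] := ev l.
  rewrite opprD addrACA; apply: (absval_add_lt Hv); first exact: absval_sub_lt.
  rewrite -hornerN -hornerD -rmorphB; apply: absval_horner_lt1 => // j.
  by rewrite coef_map coefB; apply: absval_intM_lt1.
exists (l - k)%N; first by rewrite subn_gt0.
(* The two close powers are the [p^k]-th powers of [z ^+ (p ^ (l - k))] and [z]; injectivity of
   Frobenius removes them. *)
apply: (absval_frobenius_inj (n := k)) => //.
  by rewrite (absvalX Hv) exprn_ile1 ?(absval_ge0 Hv).
by rewrite -exprM -expnD subnK ?(ltnW kl) // (absval_distC Hv).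
Qed.

End ResidueChar.

(** * Properties of C_p: closedness and the residue field *)

Section CpFacts.
Variables (R : realType) (p : nat).
Hypothesis p_prime : prime p.

Lemma padic_abs_p_lt1 : @padic_abs R p p%:R < 1.
Proof.
have p0 := prime_gt0 p_prime.
rewrite /padic_abs pnatr_eq0 gtn_eqF //.
rewrite -[p%:R : rat]/(p%:Z%:Q) numq_int denq_int absz1 logn1 absz_nat logn_prime // eqxx.
rewrite sub0r -invr_expz expr1z invf_lt1 ?ltr0n ?ltr1n //.
exact: prime_gt1.
Qed.

Section Rounding.
Variables (Qp : fieldType) (v0 : Qp -> R) (i0 : {rmorphism rat -> Qp}).
Hypothesis Qc : is_completion (@padic_abs R p) v0 i0.

Let Hv : nonarch_absval v0. Proof. by case: Qc. Qed.

Lemma completion_absval_p_lt1 : v0 p%:R < 1.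
Proof.
by case: Qc => _ iso _ _; rewrite -(rmorph_nat i0) iso padic_abs_p_lt1.
Qed.

(** A rational number [y] near [x] has absolute value at most 1; being in lowest terms, its
    denominator is prime to [p]. *)
Lemma padic_residue_int (x : Qp) : v0 x <= 1 -> exists a : int, v0 (x - a%:~R) < 1.
Proof.
move=> x1; have vp := completion_absval_p_lt1.
case: (Qc) => _ iso dense _.
have [y xy] := dense x 1 ltr01.
have y1 : v0 (i0 y) <= 1.
  by rewrite -[i0 y](subKr x); apply: (absval_sub_le Hv) => //; apply: ltW.
have ey : i0 y = (numq y)%:~R / (denq y)%:~R.
  by rewrite -{1}[y]divq_num_den fmorph_div !rmorph_int.
have pd : ~~ (p %| denq y)%Z.
  apply/negP => pd; have d1 := absval_intM_lt1 Hv vp pd.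
  have pn : ~~ (p %| numq y)%Z.
    apply/negP => pn; have := coprime_num_den y.
    rewrite /coprime => /eqP g1; move: pd pn; rewrite !dvdzE /= => pd pn.
    have : (p %| gcdn `|numq y| `|denq y|)%N by rewrite dvdn_gcd pn pd.
    by rewrite g1 dvdn1 => /eqP p1; move: p_prime; rewrite p1.
  move: y1; rewrite ey (absvalM Hv) (absvalV Hv).
  rewrite (absval_int_coprime Hv p_prime vp pn) mul1r.
  rewrite leNgt invf_gt1 ?d1 // lt0r (absval_ge0 Hv) andbT.
  have d0 : i0 (denq y)%:~R != 0 by rewrite fmorph_eq0 intr_eq0 denq_neq0.
  by rewrite rmorph_int in d0; rewrite absval_eq0b.
have vd := absval_int_coprime Hv p_prime vp pd.
have cop : coprimez p%:Z (denq y) by rewrite coprimezE /= prime_coprime.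
(* Here [s * p + t * denq y = 1], so [t] inverts the denominator modulo [p] and [numq y * t] is the
   residue of [y]. *)
have [[s t] /= e] := coprimezP _ _ cop.
exists (numq y * t).
apply: (absval_dist_lt Hv (y := i0 y)) => //.
have d0 : (denq y)%:~R != 0 :> Qp.
  by rewrite -(absval_eq0b Hv) vd oner_neq0.
have -> : i0 y - (numq y * t)%:~R = (numq y)%:~R * (s * p%:Z)%:~R / (denq y)%:~R.
  have -> : s * p%:Z = 1 - t * denq y by rewrite -e addrK.
  rewrite ey; apply: (mulIf d0); rewrite mulfVK // mulrBl mulfVK //.
  by rewrite !(intrD, intrM, rmorphN) /=; ring.
rewrite (absvalM Hv) (absvalV Hv) vd invr1 mulr1 (absvalM Hv).
apply: (@le_lt_trans _ _ (v0 (s * p%:Z)%:~R)).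
  by rewrite ler_piMl ?(absval_ge0 Hv) ?absval_int_le1.
by apply: (absval_intM_lt1 Hv vp); rewrite dvdz_mull.
Qed.

(** Divide an equation of [z] by its coefficient of largest absolute value, taking the last index
    [d] where the maximum occurs. The coefficients above [d] become less than 1, those below round
    to integers, and a monic polynomial of degree [d] with small value at [z] remains. *)
Lemma algebraic_integral_mod (F : closedFieldType) (v1 : F -> R)
    (i1 : {rmorphism Qp -> F}) (z : F) :
  nonarch_absval v1 -> (forall x, v1 (i1 x) = v0 x) -> algebraicOver i1 z ->
  v1 z <= 1 ->
  exists2 h : {poly int}, h \is monic & v1 (map_poly intr h).[z] < 1.
Proof.
move=> H1 iso [q q0 qz] z1.
pose P d := (d < size q)%N && [forall k : 'I_(size q), v0 q`_k <= v0 q`_d].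
have sq : (0 < size q)%N by rewrite size_poly_gt0.
have exP : exists d, P d.
  pose k0 := Ordinal sq.
  pose k1 := [arg max_(k > k0) v0 q`_k]%O.
  exists k1; rewrite /P ltn_ord /=; apply/forallP => k.
  by rewrite /k1; case: arg_maxP => // k2 _ /(_ k isT).
have ub d : P d -> (d <= size q)%N by case/andP => /ltnW.
case: (ex_maxnP exP ub) => d /andP[dq /forallP dmax] dlast.
have qmax k : v0 q`_k <= v0 q`_d.
  have [kq|qk] := ltnP k (size q); first exact: (dmax (Ordinal kq)).
  by rewrite nth_default // absval0 // (absval_ge0 Hv).
have qlast k : (d < k)%N -> v0 q`_k < v0 q`_d.
  move=> dk; rewrite ltNge; apply/negP => h.
  have kq : (k < size q)%N.
    rewrite ltnNge; apply/negP => qk.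
    have d0 : v0 q`_d = 0.
      apply/eqP; rewrite eq_le (absval_ge0 Hv) andbT.
      by apply: (le_trans h); rewrite nth_default // absval0.
    have := qmax (size q).-1; rewrite d0 -lead_coefE leNgt absval_gt0 //.
    by rewrite lead_coef_eq0 q0.
  have := dlast k; rewrite leqNgt dk /= => /(_ _)/negP; apply => //.
  by rewrite /P kq; apply/forallP => j; apply: le_trans h.
have qd0 : 0 < v0 q`_d.
  by apply: le_lt_trans (qlast d.+1 (leqnn _)); apply: (absval_ge0 Hv).
pose g := (q`_d)^-1 *: q.
have g1 k : v0 g`_k <= 1.
  by rewrite coefZ (absvalM Hv) (absvalV Hv) mulrC ler_pdivrMr // mul1r.
have gd : g`_d = 1 by rewrite coefZ mulVf // -(absval_gt0 Hv).
have glast k : (d < k)%N -> v0 g`_k < 1.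
  by move=> /qlast h; rewrite coefZ (absvalM Hv) (absvalV Hv) mulrC ltr_pdivrMr // mul1r.
have [A hA] := choice (fun k => padic_residue_int (g1 k)).
pose h0 : {poly int} := \poly_(k < d) A k.
have sh : (size h0 < size ('X^d : {poly int})%R)%N by rewrite size_polyXn ltnS size_poly.
exists ('X^d + h0).
  by rewrite monicE lead_coefDl // lead_coefXn.
have gz : (map_poly i1 g).[z] = 0.
  by rewrite linearZ /= hornerZ (rootP qz) mulr0.
rewrite -[_.[z]]subr0 -gz -hornerN -hornerD.
apply: (absval_horner_lt1 H1) => // j.
rewrite coefB !coef_map coefD coefXn coef_poly.
rewrite -[X in X - _](rmorph_int i1) -rmorphB iso (absval_distC Hv).
have [jd|jd|->] := ltngtP j d; first by rewrite add0r.
  by rewrite add0r subr0 glast.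
by rewrite addr0 gd subrr absval0.
Qed.

End Rounding.

Variables (C : fieldType) (v : C -> R).

(* The last two fields: C is algebraically closed, and its residue field is
   algebraic over F_p. *)
Record Cp_like : Prop := {
  Cp_absval : nonarch_absval v;
  Cp_complete : complete_absval v;
  Cp_abs_p_lt1 : v p%:R < 1;
  Cp_natr_eq0 : forall n, (n%:R == 0 :> C) = (n == 0)%N;
  Cp_root : forall q : {poly C}, size q != 1 -> exists x, root q x;
  Cp_residue_period : forall x, v x <= 1 ->
    exists2 l : nat, (0 < l)%N & v (x ^+ (p ^ l) - x) < 1 }.

(** For the residue period, replace [x] by an algebraic point at distance less than 1. That point
    satisfies a monic integer equation up to an error below 1, and its period carries over to
    [x]. *)
Lemma is_Cp_Cp_like : is_Cp p v -> Cp_like.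
Proof.
case=> Qp [v0 [i0 [F [v1 [i1 [i2 [Qc alg H1 iso Fc]]]]]]].
case: (Fc) => Hv iso2 dense compl.
have vp : v p%:R < 1.
  rewrite -(rmorph_nat i2) iso2 -(rmorph_nat i1) iso.
  exact: completion_absval_p_lt1 Qc.
split=> // [n||x x1].
- rewrite -(rmorph_nat i2) fmorph_eq0 -(rmorph_nat i1) fmorph_eq0.
  by rewrite -(rmorph_nat i0) fmorph_eq0 pnatr_eq0.
- exact: completion_root Fc.
 have [z xz] := dense x 1 ltr01.
have iz1 : v (i2 z) <= 1.
  by rewrite -[i2 z](subKr x); apply: (absval_sub_le Hv) => //; apply: ltW.
have z1 : v1 z <= 1 by rewrite -iso2.
have [h hm hz] := algebraic_integral_mod Qc H1 iso (alg z) z1.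
have hz2 : v (map_poly intr h).[i2 z] < 1.
  move: hz; rewrite -iso2 -horner_map -map_poly_comp.
  by congr (v _.[_] < 1); apply: eq_map_poly => y /=; rewrite rmorph_int.
have [l l0 hl] := integral_mod_period Hv p_prime vp hm iz1 hz2.
exists l => //.
apply: (absval_dist_lt Hv (y := i2 z)); last by rewrite (absval_distC Hv).
apply: (absval_dist_lt Hv (y := i2 z ^+ (p ^ l))) => //.
exact: le_lt_trans (absval_subX_le Hv _ x1 iz1) xz.
Qed.

End CpFacts.

(** * Means over roots of unity *)

Section UnityMean.
Variable C : fieldType.
Hypothesis char0 : forall n, (n%:R == 0 :> C) = (n == 0)%N.
Hypothesis root_exists : forall q : {poly C}, size q != 1 -> exists x, root q x.

Lemma poly_splits (q : {poly C}) :
  exists s : seq C, q = lead_coef q *: \prod_(z <- s) ('X - z%:P).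
Proof.
have [n] := ubnP (size q); elim: n q => // n IH q.
rewrite ltnS => qn; have [q1|/root_exists [x /factor_theorem [r qr]]] := eqVneq (size q) 1%N.
  exists [::]; rewrite big_nil.
  by move/eqP: q1 => /size_poly1P [c c0 ->]; rewrite lead_coefC alg_polyC.
have [q0|q0] := eqVneq q 0; first by exists [::]; rewrite q0 lead_coef0 scale0r.
have r0 : r != 0 by apply: contraNneq q0 => r0; rewrite qr r0 mul0r.
have rn : (size r < n)%N.
  by apply: leq_trans qn; rewrite qr size_Mmonic ?monicXsubC // size_XsubC addn2.
have [s hs] := IH r rn; exists (x :: s).
rewrite {1}qr big_cons mulrC {1}hs -scalerAr; congr (_ *: _).
by rewrite qr lead_coefM lead_coefXsubC mulr1.
Qed.

(** In characteristic 0 the polynomial [X^N - 1] is separable, so it has [N] distinct roots; among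
    them is a primitive one. *)
Lemma prim_root_exists N : (0 < N)%N -> exists z : C, N.-primitive_root z.
Proof.
move=> N0; have [s hs] := poly_splits ('X^N - 1).
have qm : 'X^N - 1 \is @monic C by rewrite -[1]/(1%:P) monicXnsubC.
move: hs; rewrite (monicP qm) scale1r => hs.
have ss : size s = N.
  by have := size_XnsubC (1 : C) N0; rewrite hs size_prod_XsubC => -[].
have /hasP[z _ zP] : has N.-primitive_root s; last by exists z.
apply: has_prim_root; rewrite ?ss //.
  apply/allP => z zs; rewrite /root_of_unity.
  by rewrite hs root_prod_XsubC.
rewrite -separable_prod_XsubC -hs; apply: cyclotomic.separable_Xn_sub_1.
by rewrite char0 -lt0n.
Qed.

Definition unity_mean (N : nat) (g : C -> C) : C :=
  N%:R^-1 * \sum_(zeta \in [set z : C | z ^+ N = 1]) g zeta.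

(** The powers of a primitive root run through the roots of unity once each, which turns the sum
    over a set into an indexed sum. *)
Lemma unity_mean_prim N (z : C) g : N.-primitive_root z ->
  unity_mean N g = N%:R^-1 * \sum_(i < N) g (z ^+ i).
Proof.
move=> zP; rewrite /unity_mean; congr (_ * _).
rewrite (@fsbig_ord _ _ _ N (fun i => g (z ^+ i))).
apply: (@reindex_fsbig _ _ _ _ _ (fun i => z ^+ i)); split=> [i /= _|i j|x /= /(prim_rootP zP)[i ->]].
- by rewrite -exprM mulnC exprM (prim_expr_order zP) expr1n.
- rewrite !inE /= => iN jN /eqP.
  by rewrite (eq_prim_root_expr zP) !modn_small // => /eqP.
- by exists i => //=.
Qed.

Variable N : nat.
Hypothesis N0 : (0 < N)%N.

Lemma eq_unity_mean g h : (forall x, x ^+ N = 1 -> g x = h x) ->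
  unity_mean N g = unity_mean N h.
Proof.
move=> gh; congr (_ * _); apply: eq_fsbigr => x; rewrite inE /=; exact: gh.
Qed.

Lemma unity_meanD g h :
  unity_mean N (fun x => g x + h x) = unity_mean N g + unity_mean N h.
Proof.
have [z zP] := prim_root_exists N0.
by rewrite !(unity_mean_prim _ zP) big_split mulrDr.
Qed.

Lemma unity_meanZ c g : unity_mean N (fun x => c * g x) = c * unity_mean N g.
Proof.
have [z zP] := prim_root_exists N0.
by rewrite !(unity_mean_prim _ zP) -mulr_sumr mulrCA.
Qed.

Lemma unity_mean_sum (I : Type) (r : seq I) (P : pred I) (g : I -> C -> C) :
  unity_mean N (fun x => \sum_(i <- r | P i) g i x) =
  \sum_(i <- r | P i) unity_mean N (g i).
Proof.
have [z zP] := prim_root_exists N0.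
rewrite (unity_mean_prim _ zP) exchange_big /= mulr_sumr.
by apply: eq_bigr => i _; rewrite (unity_mean_prim _ zP).
Qed.

(** If [N] does not divide [k], the sum is geometric with ratio [z ^+ k != 1] and vanishes. *)
Lemma unity_meanX k : unity_mean N (fun x => x ^+ k) = (N %| k)%N%:R.
Proof.
have [z zP] := prim_root_exists N0.
have Nn0 : N%:R != 0 :> C by rewrite char0 -lt0n.
rewrite (unity_mean_prim _ zP); under eq_bigr => i _ do rewrite -exprM mulnC exprM.
have [Nk|Nk] := boolP (N %| k)%N.
  have -> : z ^+ k = 1 by apply/eqP; rewrite -(prim_order_dvd zP).
  under eq_bigr => i _ do rewrite expr1n.
  by rewrite sumr_const card_ord mulVf.
have w1 : z ^+ k - 1 != 0 by rewrite subr_eq0 -(prim_order_dvd zP).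
suff -> : \sum_(i < N) (z ^+ k) ^+ i = 0 by rewrite mulr0.
apply: (mulfI w1); rewrite mulr0 -subrX1 -exprM mulnC exprM.
by rewrite (prim_expr_order zP) expr1n subrr.
Qed.

Lemma unity_mean_horner (P : {poly C}) :
  unity_mean N (horner P) = \sum_(i < size P | (N %| i)%N) P`_i.
Proof.
rewrite (eq_unity_mean (h := fun x => \sum_(i < size P) P`_i * x ^+ i)); last first.
  by move=> x _; rewrite horner_coef.
rewrite unity_mean_sum [RHS]big_mkcond /=; apply: eq_bigr => i _.
by rewrite unity_meanZ unity_meanX mulr_natr mulrb.
Qed.

(** On the roots of unity [(b^N - 1) / (b - x) = (b^N - x^N) / (b - x)] is a polynomial in [x] of
    degree below [N]; its mean is its constant coefficient [b^(N-1)]. *)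
Lemma unity_mean_pole (b : C) : b ^+ N != 1 ->
  unity_mean N (fun x => (b - x)^-1) = b ^+ N.-1 / (b ^+ N - 1).
Proof.
move=> bN; have bN1 : b ^+ N - 1 != 0 by rewrite subr_eq0.
rewrite (eq_unity_mean (h := fun x => (b ^+ N - 1)^-1 *
   \sum_(i < N) b ^+ (N.-1 - i) * x ^+ i)); last first.
  move=> x xN; have bx : b - x != 0.
    by rewrite subr_eq0; apply: contraNneq bN => ->; rewrite xN.
  apply: (mulfI bx); rewrite divff // mulrCA -[X in b ^+ N - X]xN.
  rewrite [_ * \sum_(_ < _) _](_ : _ = b ^+ N - x ^+ N) ?mulVf ?xN //.
  rewrite -xN subrXX; congr (_ * _).
rewrite unity_meanZ unity_mean_sum (bigD1 (Ordinal N0)) //=.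
rewrite unity_meanZ unity_meanX dvdn0 mulr1 subn0.
rewrite big1 ?addr0 1?mulrC // => i i0.
rewrite unity_meanZ unity_meanX gtnNdvd ?mulr0 // lt0n.
by apply: contraNneq i0 => i0; apply/eqP/val_inj.
Qed.

End UnityMean.

(** * Bounded power series on the disc |u - 1| < 1 *)

(** The number [m - j + i] lies strictly between 0 and [2 m] and differs from [m]. *)
Lemma dvdn_sub_add_false m i j : (i < m)%N -> (j < m)%N -> i != j ->
  (m %| m - j + i)%N = false.
Proof.
move=> im jm ij; apply/negP => /dvdnP[[|[|k]]]; rewrite ?mulSn; move/eqP: ij; lia.
Qed.

Section UnitDisc.
Variables (R : realType) (p : nat) (C : fieldType) (v : C -> R).
Hypotheses (p_prime : prime p) (HC : Cp_like p v).

Let Hv := Cp_absval HC.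
Let char0 := Cp_natr_eq0 HC.
Let root_exists := Cp_root HC.
Let vp := Cp_abs_p_lt1 HC.

Let pX_gt0 n : (0 < p ^ n)%N. Proof. by rewrite expn_gt0 prime_gt0. Qed.

Lemma absval_unity_root (x : C) N : (0 < N)%N -> x ^+ N = 1 -> v x = 1.
Proof.
move=> N0 xN; apply/eqP; rewrite -(@pexpr_eq1 _ _ N) ?(absval_ge0 Hv) //.
by rewrite -(absvalX Hv) xN (absval1 Hv).
Qed.

(** Injectivity of Frobenius on residues, applied to [x] and 1. Means over [p^n]-th roots of unity
    thus only see values in the disc. *)
Lemma pX_unity_root_disc (x : C) n : x ^+ (p ^ n) = 1 -> v (x - 1) < 1.
Proof.
move=> xN; apply: (absval_frobenius_inj Hv p_prime vp (n := n)).
- by rewrite (absval_unity_root _ xN).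
- by rewrite (absval1 Hv).
by rewrite xN expr1n subrr (absval0 Hv).
Qed.

Definition psum (c : nat -> C) (n : nat) (u : C) : C :=
  \sum_(i < n) c i * (u - 1) ^+ i.

(** [M] bounds the coefficients rather than the values, since coefficients are what control the
    means. *)
Definition bounded_series (g : C -> C) (c : nat -> C) (M : R) : Prop :=
  (forall i, v (c i) <= M) /\
  forall u, v (u - 1) < 1 -> converges v (fun n => psum c n u) (g u).

Lemma bounded_seriesD g h c d M :
  bounded_series g c M -> bounded_series h d M ->
  bounded_series (fun u => g u + h u) (fun i => c i + d i) M.
Proof.
move=> [cM cg] [dM dh]; split=> [i|u u1]; first exact: absval_add_le.
have := convergesD Hv (cg u u1) (dh u u1).
congr (converges v _ _); apply/funext => n.
by rewrite /psum -big_split; apply: eq_bigr => i _; rewrite mulrDl.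
Qed.

Lemma bounded_seriesZ g c M a :
  bounded_series g c M ->
  bounded_series (fun u => a * g u) (fun i => a * c i) (v a * M).
Proof.
move=> [cM cg]; split=> [i|u u1].
  by rewrite (absvalM Hv) ler_wpM2l ?(absval_ge0 Hv).
have := convergesZ Hv a (cg u u1).
congr (converges v _ _); apply/funext => n.
by rewrite /psum mulr_sumr; apply: eq_bigr => i _; rewrite mulrA.
Qed.

Lemma bounded_series_le g c M M' :
  M <= M' -> bounded_series g c M -> bounded_series g c M'.
Proof. by move=> MM' [cM cg]; split=> // i; apply: le_trans MM'. Qed.

Lemma eq_bounded_series g h c M :
  (forall u, v (u - 1) < 1 -> g u = h u) ->
  bounded_series g c M -> bounded_series h c M.
Proof. by move=> gh [cM cg]; split=> // u u1; rewrite -gh //; apply: cg. Qed.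

Lemma bounded_series_ge0 g c M : bounded_series g c M -> 0 <= M.
Proof. by case=> cM _; apply: le_trans (cM 0%N); apply: (absval_ge0 Hv). Qed.

Lemma psum_tail c M m n u : (forall i, v (c i) <= M) -> v (u - 1) < 1 ->
  (n <= m)%N -> v (psum c m u - psum c n u) <= M * v (u - 1) ^+ n.
Proof.
move=> cM u1 nm; have M0 : 0 <= M by apply: le_trans (cM 0%N); apply: (absval_ge0 Hv).
rewrite /psum -!(big_mkord xpredT (fun i => c i * (u - 1) ^+ i)).
rewrite (big_cat_nat (n := n)) //= addrAC subrr add0r big_nat.
apply: (absval_sum_le Hv) => [|i /andP[ni _]].
  by rewrite mulr_ge0 ?exprn_ge0 ?(absval_ge0 Hv).
rewrite (absvalM Hv) (absvalX Hv) ler_pM ?exprn_ge0 ?(absval_ge0 Hv) //.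
by rewrite ler_wiXn2l ?(absval_ge0 Hv) // ltW.
Qed.

Lemma bounded_series_tail g c M n u : bounded_series g c M -> v (u - 1) < 1 ->
  v (g u - psum c n u) <= M * v (u - 1) ^+ n.
Proof.
move=> [cM cg] u1; apply: (converges_le Hv (N := n)) (cg u u1) _ => m nm.
exact: psum_tail.
Qed.

Lemma unity_mean_psum_le c M N m : (0 < N)%N -> (forall i, v (c i) <= M) ->
  v (unity_mean N (psum c m)) <= M.
Proof.
move=> N0 cM; have M0 : 0 <= M by apply: le_trans (cM 0%N); apply: (absval_ge0 Hv).
rewrite (unity_mean_sum char0 root_exists N0); apply: (absval_sum_le Hv) => // i _.
rewrite (unity_meanZ char0 root_exists N0) (absvalM Hv) -[M]mulr1.
rewrite ler_pM ?(absval_ge0 Hv) //.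
(* [(X - 1)^i] has integer coefficients; its mean adds up those whose index is divisible by [N]. *)
pose P : {poly C} := map_poly intr (('X - 1) ^+ i : {poly int}).
rewrite (eq_unity_mean (h := horner P)); last first.
  move=> x _; rewrite /P rmorphXn rmorphB /= map_polyX rmorph1.
  by rewrite horner_exp hornerD hornerX hornerN hornerC.
rewrite (unity_mean_horner char0 root_exists N0); apply: (absval_sum_le Hv) => // j _.
by rewrite coef_map; apply: absval_int_le1.
Qed.

Lemma unity_mean_converges (s : nat -> C -> C) g N : (0 < N)%N ->
  (forall x, x ^+ N = 1 -> converges v (fun n => s n x) (g x)) ->
  converges v (fun n => unity_mean N (s n)) (unity_mean N g).
Proof.
move=> N0 h; have [z zP] := prim_root_exists char0 root_exists N0.
rewrite (unity_mean_prim _ zP).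
have -> : (fun n => unity_mean N (s n)) =
    (fun n => N%:R^-1 * \sum_(i < N) s n (z ^+ i)).
  by apply/funext => n; rewrite (unity_mean_prim _ zP).
apply: (convergesZ Hv).
apply: (converges_sum Hv) => i; apply: h.
by rewrite -exprM mulnC exprM (prim_expr_order zP) expr1n.
Qed.

(* p^-n \sum_\zeta (\zeta - 1)^i is an integer, so the mean is bounded by the
   coefficients although |p^-n| is large. *)
Lemma unity_mean_bounded_series g c M n : bounded_series g c M ->
  v (unity_mean (p ^ n) g) <= M.
Proof.
move=> [cM cg].
apply: (converges_absval_le Hv (s := fun m => unity_mean (p ^ n) (psum c m)) (N := 0)).
  apply: unity_mean_converges => // x xN; apply: cg.
  exact: pX_unity_root_disc xN.
by move=> m _; apply: unity_mean_psum_le.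
Qed.

(** The order [m] is prime to [p], so dividing by it leaves absolute values unchanged. *)
Lemma absval_unity_mean_le g M m : ~~ (p %| m)%N ->
  (forall x, v x = 1 -> v (g x) <= M) -> v (unity_mean m g) <= M.
Proof.
move=> pm gM; have m0 : (0 < m)%N by case: m pm => //; rewrite dvdn0.
have M0 : 0 <= M.
  by apply: le_trans (gM 1 (absval1 Hv)); apply: (absval_ge0 Hv).
have [z zP] := prim_root_exists char0 root_exists m0.
rewrite (unity_mean_prim _ zP) (absvalM Hv) (absvalV Hv).
rewrite (absval_nat_coprime Hv p_prime vp pm) invr1 mul1r.
apply: (absval_sum_le Hv) => // i _; apply: gM.
by rewrite (absvalX Hv) (absval_unity_root m0 (prim_expr_order zP)) expr1n.
Qed.

(* The coefficient is isolated by averaging over roots of unity of order prime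
   to p: as the order has absolute value 1, the mean is at most the supremum. *)
Lemma bounded_series_cauchy_radius g c B M rho j :
  bounded_series g c B -> (forall u, v (u - 1) < 1 -> v (g u) <= M) -> 0 < M ->
  v rho < 1 -> v (c j) * v rho ^+ j <= M.
Proof.
move=> bs gM M0 rho1.
have B0 := bounded_series_ge0 bs.
have rho_ge0 := absval_ge0 Hv rho.
(* Beyond [n0] the tail of the series is at most [M] on the circle of radius [v rho]. *)
have [n0 hn0] : exists N, forall n, (N <= n)%N -> B * v rho ^+ n <= M.
  have B1 : 0 < B + 1 by rewrite ltr_wpDl.
  have [|N hN] := exp_small _ (divr_gt0 M0 B1) (x := v rho).
    by rewrite rho_ge0.
  exists N => n /hN; rewrite ltr_pdivlMr // => h; apply: ltW; apply: le_lt_trans h.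
  by rewrite mulrC ler_wpM2l ?exprn_ge0 // lerDl.
pose n := (maxn n0 j.+1).
have jn : (j < n)%N by rewrite leq_maxr.
have {}hn0 : B * v rho ^+ n <= M by apply: hn0; rewrite leq_maxl.
(* This order is prime to [p] and exceeds the number [n] of terms. *)
pose m := (p * n).+1.
have nm : (n < m)%N by rewrite ltnS leq_pmull // prime_gt0.
have pm : ~~ (p %| m)%N.
  rewrite /m -addn1 dvdn_addr ?dvdn_mulr // dvdn1.
  by apply: contraTneq p_prime => ->.
have m0 : (0 < m)%N by [].
(* The factor [x ^+ (m - j)] moves the term of index [j] to exponent [m], the only exponent
   divisible by [m] that occurs. *)
pose h (x : C) := x ^+ (m - j) * psum c n (1 + rho * x).
have hM : v (unity_mean m h) <= M.
  apply: absval_unity_mean_le => // x x1.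
  rewrite /h (absvalM Hv) (absvalX Hv) x1 expr1n mul1r.
  set u := 1 + rho * x.
  have ur : v (u - 1) = v rho by rewrite /u addrAC subrr add0r (absvalM Hv) x1 mulr1.
  have u1 : v (u - 1) < 1 by rewrite ur.
  rewrite -[psum c n u](subKr (g u)); apply: (absval_sub_le Hv); first exact: gM.
  by apply: (le_trans (bounded_series_tail n bs u1)); rewrite ur.
have he : unity_mean m h = c j * rho ^+ j.
  rewrite (eq_unity_mean (h := fun x => \sum_(i < n) (c i * rho ^+ i) * x ^+ (m - j + i))); last first.
    move=> x _; rewrite /h /psum mulr_sumr; apply: eq_bigr => i _.
    by rewrite addrAC subrr add0r exprMn exprD mulrCA -!mulrA; congr (_ * _); rewrite mulrCA.
  rewrite (unity_mean_sum char0 root_exists m0) (bigD1 (Ordinal jn)) //=.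
  rewrite (unity_meanZ char0 root_exists m0) (unity_meanX char0 root_exists m0).
  rewrite subnK ?dvdnn ?mulr1; last by rewrite ltnW // (ltn_trans jn).
  rewrite big1 ?addr0 // => i ij.
  rewrite (unity_meanZ char0 root_exists m0) (unity_meanX char0 root_exists m0).
  have ijn : (i != j :> nat) by apply: contraNneq ij => ij; apply/eqP/val_inj.
  by rewrite dvdn_sub_add_false ?mulr0 // (ltn_trans _ nm).
by rewrite -(absvalX Hv) -(absvalM Hv) -he.
Qed.

Lemma absval_p_gt0 : 0 < v p%:R.
Proof. by rewrite (absval_gt0 Hv) char0 -lt0n prime_gt0. Qed.

(** Let the radius tend to 1 through [k]-th roots [rho] of [p]. This gives
    [v (c j) ^+ k * v p%:R ^+ j <= M ^+ k] for all [k > 0], which fails for large [k] if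
    [M < v (c j)]. *)
Lemma bounded_series_cauchy g c B M :
  bounded_series g c B -> (forall u, v (u - 1) < 1 -> v (g u) <= M) -> 0 < M ->
  bounded_series g c M.
Proof.
move=> bs gM M0; split; last by case: bs.
move=> j; rewrite leNgt; apply/negP => Mc.
have c0 : 0 < v (c j) by apply: lt_trans Mc.
have key k : (0 < k)%N -> v (c j) ^+ k * v p%:R ^+ j <= M ^+ k.
  move=> k0.
  have [rho /rootP] : exists rho : C, root ('X^k - p%:R%:P) rho.
    by apply: root_exists; rewrite size_XnsubC // eqSS -lt0n.
  rewrite hornerD hornerN hornerXn hornerC => /eqP; rewrite subr_eq0 => /eqP rk.
  have rho1 : v rho < 1.
    by rewrite -(expr_lt1 k0) ?(absval_ge0 Hv) // -(absvalX Hv) rk.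
  have h := bounded_series_cauchy_radius j bs gM M0 rho1.
  rewrite -rk (absvalX Hv) -exprM mulnC exprM -exprMn.
  by rewrite lerXn2r ?nnegrE ?mulr_ge0 ?exprn_ge0 ?(absval_ge0 Hv) ?(ltW M0).
have [|N hN] := exp_small (x := M / v (c j)) _ (exprn_gt0 j absval_p_gt0).
  by rewrite divr_ge0 ?(ltW M0) ?(ltW c0) //= ltr_pdivrMr // mul1r.
have := hN N.+1 (leqnSn _); rewrite expr_div_n ltr_pdivrMr ?exprn_gt0 //.
by rewrite mulrC ltNge key.
Qed.

End UnitDisc.

(** * Limits of means along a path *)

(** The absolute value only serves to land in [nat]; it matters for finitely many [k] when
    [l > 0]. *)
Definition path_exp (alpha : int) (l k : nat) : nat := `|(alpha + (l * k)%:Z)%R|%N.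

Lemma path_exp_large alpha l n : (0 < l)%N ->
  exists K, forall k, (K <= k)%N -> (n <= path_exp alpha l k)%N.
Proof.
move=> l0; exists (`|alpha| + n)%N => k; rewrite /path_exp.
have : (k <= l * k)%N by rewrite leq_pmull.
by move: (l * k)%N => x; lia.
Qed.

Lemma path_expS alpha l : exists K, forall k, (K <= k)%N ->
  path_exp alpha l k.+1 = (l + path_exp alpha l k)%N.
Proof.
have [->|l0] := posnP l; first by exists 0%N => k _; rewrite /path_exp !mul0n.
exists `|alpha|%N => k; rewrite /path_exp mulnS.
have : (k <= l * k)%N by rewrite leq_pmull.
by move: (l * k)%N => x; lia.
Qed.

Section Means.
Variables (R : realType) (p : nat) (C : fieldType) (v : C -> R).
Hypotheses (p_prime : prime p) (HC : Cp_like p v).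
Variable alpha : int.

Let Hv := Cp_absval HC.
Let char0 := Cp_natr_eq0 HC.
Let root_exists := Cp_root HC.
Let vp := Cp_abs_p_lt1 HC.

Let pX_gt0 n : (0 < p ^ n)%N. Proof. by rewrite expn_gt0 prime_gt0. Qed.

Definition path_limit (g : C -> C) (l : nat) (L : C) : Prop :=
  converges v (fun k => unity_mean (p ^ path_exp alpha l k) g) L.

(** A progression of step [l * m] is a subsequence of that of step [l]; in this way two functions
    are brought to a common step. *)
Lemma path_limit_mul g l m L : (0 < m)%N -> path_limit g l L ->
  path_limit g (l * m) L.
Proof.
move=> m0 h e e0; have [K hK] := h e e0; exists K => k Kk.
rewrite /path_exp -mulnA; apply: hK.
by apply: leq_trans Kk _; rewrite leq_pmull.
Qed.

Definition has_path_limit (g : C -> C) : Prop :=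
  exists l L, (0 < l)%N /\ path_limit g l L.

Lemma eq_has_path_limit g h : (forall u, v (u - 1) < 1 -> g u = h u) ->
  has_path_limit g -> has_path_limit h.
Proof.
move=> gh [l [L [l0 gL]]]; exists l, L; split=> // e /gL[K hK].
exists K => k /hK; rewrite (eq_unity_mean (h := h)) // => x xN; apply: gh.
exact: (pX_unity_root_disc p_prime HC) xN.
Qed.

Lemma has_path_limitD g h : has_path_limit g -> has_path_limit h ->
  has_path_limit (fun u => g u + h u).
Proof.
move=> [l [L [l0 gL]]] [l' [L' [l'0 hL']]].
exists (l * l')%N, (L + L'); split; first by rewrite muln_gt0 l0.
have := convergesD Hv (path_limit_mul l'0 gL) (path_limit_mul l0 hL').
rewrite (mulnC l'); congr (converges v _ _); apply/funext => k.
by rewrite (unity_meanD char0 root_exists).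
Qed.

Lemma has_path_limitZ a g : has_path_limit g -> has_path_limit (fun u => a * g u).
Proof.
move=> [l [L [l0 gL]]]; exists l, (a * L); split=> //.
have := convergesZ Hv a gL.
by congr (converges v _ _); apply/funext => k; rewrite (unity_meanZ char0 root_exists).
Qed.

(** Once the order exceeds the degree, the mean is the constant coefficient. *)
Lemma has_path_limit_horner (P : {poly C}) : has_path_limit (horner P).
Proof.
exists 1%N, P`_0; split=> // e e0.
have [K hK] := path_exp_large alpha (size P) (ltn0Sn 0).
exists K => k /hK; set n := path_exp _ _ _ => nP.
suff -> : unity_mean (p ^ n) (horner P) = P`_0 by rewrite subrr absval0.
rewrite (unity_mean_horner char0 root_exists) //.
have [P0|P0] := posnP (size P).
  have Pn j : P`_j = 0 by rewrite nth_default // P0.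
  by rewrite Pn big1 // => i _; apply: Pn.
rewrite (bigD1 (Ordinal P0)) //= big1 ?addr0 // => i /andP[di i0].
have i1 : (0 < i)%N by rewrite lt0n; apply: contraNneq i0 => i0; apply/eqP/val_inj.
suff : (i < p ^ n)%N by move=> /(gtnNdvd i1); rewrite di.
apply: leq_ltn_trans (_ : (n < p ^ n)%N); last by rewrite ltn_expl // prime_gt1.
exact: leq_trans (ltnW (ltn_ord i)) nP.
Qed.

(** With [l] a period of the residue of [x], consecutive terms involve the [p^n]-th powers of [x]
    and of the nearby point [y = x ^+ (p ^ l)], which Frobenius contracts. *)
Lemma frobenius_orbit_converges x : v x <= 1 -> 1 <= v (x - 1) ->
  exists2 l, (0 < l)%N &
    exists w, converges v (fun k => (1 - x ^+ (p ^ path_exp alpha l k))^-1) w.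
Proof.
move=> x1 x_far; have [l l0 hl] := Cp_residue_period HC x1.
exists l => //; apply: (Cp_complete HC).
pose y := x ^+ (p ^ l).
have y1 : v y <= 1 by rewrite (absvalX Hv) exprn_ile1 ?(absval_ge0 Hv).
pose t := Num.max (v (x - y)) (v p%:R).
have t1 : 0 <= t < 1.
  by rewrite le_max (absval_ge0 Hv) gt_max vp (absval_distC Hv) hl.
(* Residues different from 1 stay different under Frobenius, so the denominators have absolute value
   at least 1. *)
have far n : 1 <= v (1 - x ^+ (p ^ n)).
  rewrite leNgt; apply/negP => h.
  have := absval_frobenius_inj Hv p_prime vp (n := n) (x := 1) (y := x).
  rewrite expr1n (absval1 Hv) => /(_ (lexx _) x1 h).
  by rewrite (absval_distC Hv) ltNge x_far.
have nz n : 1 - x ^+ (p ^ n) != 0.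
  by rewrite -(absval_gt0 Hv) (lt_le_trans ltr01).
apply: (cauchy_of_steps Hv) => e e0.
have [n0 hn0] := exp_small t1 e0.
have [K hK] := path_exp_large alpha n0 l0.
have [K' hK'] := path_expS alpha l.
exists (maxn K K') => k; rewrite geq_max => /andP[/hK kn /hK' ->].
set n := path_exp alpha l k.
have -> : (1 - x ^+ (p ^ n))^-1 - (1 - x ^+ (p ^ (l + n)))^-1 =
    (x ^+ (p ^ n) - y ^+ (p ^ n)) / (1 - x ^+ (p ^ n)) / (1 - x ^+ (p ^ (l + n))).
  rewrite /y -exprM -expnD; have := nz n; have := nz (l + n)%N.
  set a := x ^+ _; set b := x ^+ _ => na nb; field.
  by rewrite na nb.
rewrite !(absvalM Hv) !(absvalV Hv).
have vfar m : 0 <= (v (1 - x ^+ (p ^ m)))^-1 <= 1.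
  by rewrite invr_ge0 (absval_ge0 Hv) invf_le1 ?far // (lt_le_trans ltr01).
apply: (@le_lt_trans _ _ (v (x ^+ (p ^ n) - y ^+ (p ^ n)))).
  rewrite -mulrA ler_piMr ?(absval_ge0 Hv) // mulr_ile1 //.
  - by case/andP: (vfar n).
  - by case/andP: (vfar (l + n)%N).
  - by case/andP: (vfar n).
  - by case/andP: (vfar (l + n)%N).
apply: (le_lt_trans (absval_frobenius_contract Hv p_prime n x1 y1)).
apply: le_lt_trans (hn0 n kn).
rewrite ler_piMr ?exprn_ge0 //; first by case/andP: t1.
exact: absval_sub_le.
Qed.

Lemma has_path_limit_pole b : 1 <= v (b - 1) ->
  has_path_limit (fun u => (b - u)^-1).
Proof.
move=> b1.
have bN n : b ^+ (p ^ n) != 1.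
  by apply: contraTneq b1 => /(pX_unity_root_disc p_prime HC); rewrite -ltNge.
have [vb|vb] := leP (v b) 1.
  have [l l0 [w hw]] := frobenius_orbit_converges vb b1.
  (* For [b != 0] this comes from [b^(N-1) / (b^N - 1) = b^-1 * (1 - 1 / (1 - b^N))]. *)
  exists l, (b^-1 * (1 - w)); split=> // e e0.
  have h1 : converges v (fun=> 1 : C) 1 by move=> d d0; exists 0%N => n _; rewrite subrr absval0.
  have [K hK] := convergesZ Hv b^-1 (convergesD Hv h1 (convergesZ Hv (-1) hw)) e0.
  have [K' hK'] := path_exp_large alpha 1 l0.
  exists (maxn K K') => k; rewrite geq_max => /andP[/hK + /hK'].
  rewrite !mulN1r; set n := path_exp alpha l k => + n0.
  suff -> : unity_mean (p ^ n) (fun u => (b - u)^-1) =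
    b^-1 * (1 - (1 - b ^+ (p ^ n))^-1) by [].
  rewrite (unity_mean_pole char0 root_exists) //.
  (* For [b = 0] the formula survives through [0^-1 = 0], provided the order is greater than 1;
     hence the demand [1 <= n]. *)
  have [->|nb] := eqVneq b 0.
    rewrite invr0 mul0r expr0n.
    have : (1 < p ^ n)%N.
      by apply: leq_ltn_trans n0 _; rewrite ltn_expl // prime_gt1.
    by case: (p ^ n)%N => [|[|q]] //= _; rewrite mul0r.
  have := bN n; rewrite -[in b ^+ (p ^ n)](prednK (pX_gt0 n)) => h.
  rewrite -{2 3}(prednK (pX_gt0 n)).
  move: h; set m := (p ^ n).-1; rewrite exprS => h.
  field; rewrite nb /= -subr_eq0 in h *.
  by rewrite h -opprB oppr_eq0 h.
(* For [v b > 1] the mean equals [b^-1 / (1 - (b^-1)^N)], and [b^-1] has residue 0, different from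
   1. *)
have b0 : b != 0 by rewrite -(absval_gt0 Hv) (lt_trans ltr01).
have vi : v b^-1 < 1 by rewrite (absvalV Hv) invf_lt1 // (lt_trans ltr01).
have vi1 : 1 <= v (b^-1 - 1).
  apply: (absval_ge1_perturb Hv (x := - 1)); last by rewrite (absvalN1 Hv).
  by rewrite opprB addrA addNr sub0r (absvalN Hv).
have [l l0 [w hw]] := frobenius_orbit_converges (ltW vi) vi1.
exists l, (b^-1 * w); split=> //.
have := convergesZ Hv b^-1 hw.
congr (converges v _ _); apply/funext => k.
rewrite (unity_mean_pole char0 root_exists) //.
set n := path_exp _ _ _; have := bN n; rewrite exprVn.
rewrite -(prednK (pX_gt0 n)); set m := (p ^ n).-1; rewrite exprS /= => h.
have bm : b ^+ m != 0 by rewrite expf_neq0.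
by field; rewrite bm b0 subr_eq0 h.
Qed.

Lemma horner_bounded_series (P : {poly C}) :
  exists c B, bounded_series v (horner P) c B.
Proof.
(* The coefficients of [Q] are those of the expansion of [P] around 1. *)
pose Q := P \Po ('X + 1%:P).
have [B _ QB] := poly_coef_bounded Hv Q.
exists (fun i => Q`_i), B; split=> // u _ e e0; exists (size Q) => n Qn.
suff -> : psum (fun i => Q`_i) n u = P.[u] by rewrite subrr absval0.
rewrite -{2}[u](subrK 1) -[u - 1 + 1](_ : ('X + 1%:P).[u - 1] = _); last first.
  by rewrite hornerD hornerX hornerC.
by rewrite -horner_comp (horner_coef_wide _ Qn).
Qed.

(** The geometric series of [1 / ((b - 1) - (u - 1))]. *)
Lemma pole_bounded_series b : 1 <= v (b - 1) ->
  bounded_series v (fun u => (b - u)^-1) (fun i => (b - 1) ^- i.+1) 1.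
Proof.
move=> b1; have g0 : 0 < v (b - 1) by apply: lt_le_trans b1.
have gn0 : b - 1 != 0 by rewrite -(absval_gt0 Hv).
split=> [i|u u1 e e0].
  by rewrite (absvalV Hv) (absvalX Hv) invf_le1 ?exprn_gt0 // exprn_ege1.
have [|N hN] := exp_small (x := v (u - 1)) _ e0; first by rewrite (absval_ge0 Hv).
exists N => n /hN; apply: le_lt_trans.
have bu : 1 <= v (b - u).
  apply: (absval_ge1_perturb Hv) b1.
  by have -> : b - 1 - (b - u) = u - 1 by ring.
have bun0 : b - u != 0 by rewrite -(absval_gt0 Hv) (lt_le_trans ltr01).
have -> : psum (fun i => (b - 1) ^- i.+1) n u - (b - u)^-1 =
    - ((u - 1) / (b - 1)) ^+ n / (b - u).
  apply: (mulfI bun0); rewrite mulrBr divff // mulrCA divff // mulr1.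
  suff -> : (b - u) * psum (fun i => (b - 1) ^- i.+1) n u =
    1 - ((u - 1) / (b - 1)) ^+ n by rewrite addrAC subrr add0r.
  rewrite -[RHS]opprB subrX1.
  have -> : b - u = - ((b - 1) * ((u - 1) / (b - 1) - 1)).
    by field.
  rewrite mulNr; congr (- _); rewrite -mulrA mulrCA; congr (_ * _).
  rewrite /psum mulr_sumr; apply: eq_bigr => i _.
  by rewrite exprS invfM !mulrA divff // mul1r expr_div_n mulrC.
rewrite (absvalM Hv) (absvalN Hv) (absvalV Hv) !(absvalX Hv) (absvalM Hv) (absvalV Hv).
rewrite -[leRHS]mulr1 ler_pM ?exprn_ge0 ?mulr_ge0 ?invr_ge0 ?(absval_ge0 Hv) //.
  rewrite lerXn2r ?nnegrE ?mulr_ge0 ?invr_ge0 ?(absval_ge0 Hv) //.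
  by rewrite ler_piMr ?(absval_ge0 Hv) // invf_le1.
by rewrite invf_le1 // (lt_le_trans ltr01).
Qed.

End Means.

(** * Approximation by rational functions with simple poles *)

Section SimpleFunctions.
Variables (R : realType) (p : nat) (C : fieldType) (v : C -> R).
Hypotheses (p_prime : prime p) (HC : Cp_like p v).

Let Hv := Cp_absval HC.
Let char0 := Cp_natr_eq0 HC.
Let root_exists := Cp_root HC.
Let vp := Cp_abs_p_lt1 HC.

Let pX_gt0 n : (0 < p ^ n)%N. Proof. by rewrite expn_gt0 prime_gt0. Qed.

(** Presented by closure rules so that each property follows by induction; the last rule discards
    values outside the disc. *)
Inductive simple_fun : (C -> C) -> Prop :=
| simple_horner (P : {poly C}) : simple_fun (horner P)
| simple_pole b : 1 <= v (b - 1) -> simple_fun (fun u => (b - u)^-1)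
| simpleZ a g : simple_fun g -> simple_fun (fun u => a * g u)
| simpleD g h : simple_fun g -> simple_fun h -> simple_fun (fun u => g u + h u)
| eq_simple g h : (forall u, v (u - 1) < 1 -> g u = h u) ->
    simple_fun g -> simple_fun h.

Lemma disc_le1 u : v (u - 1) < 1 -> v u <= 1.
Proof.
move=> u1; rewrite -[u](subrK 1); apply: (absval_add_le Hv); first exact: ltW.
by rewrite (absval1 Hv).
Qed.

Lemma disc_pole b u : 1 <= v (b - 1) -> v (u - 1) < 1 -> 1 <= v (b - u).
Proof.
move=> b1 u1; apply: (absval_ge1_perturb Hv) b1.
by have -> : b - 1 - (b - u) = u - 1 by ring.
Qed.

Lemma disc_pole_neq0 b u : 1 <= v (b - 1) -> v (u - 1) < 1 -> b - u != 0.
Proof.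
by move=> b1 u1; rewrite -(absval_gt0 Hv) (lt_le_trans ltr01) // disc_pole.
Qed.

Lemma simple_bounded_series g : simple_fun g -> exists c B, bounded_series v g c B.
Proof.
elim=> {g} [P|b b1|a g _ [c [B h]]|g h _ [c [B hc]] _ [d [D hd]]|g h gh _ [c [B hc]]].
- exact: (horner_bounded_series HC).
- by do 2 eexists; apply: (pole_bounded_series HC).
- by do 2 eexists; apply: (bounded_seriesZ HC) h.
- exists (fun i => c i + d i), (Num.max B D); apply: (bounded_seriesD HC).
    by apply: bounded_series_le hc; rewrite le_max lexx.
  by apply: bounded_series_le hd; rewrite le_max lexx orbT.
- by exists c, B; apply: eq_bounded_series hc.
Qed.

Lemma simple_path_limit alpha g : simple_fun g -> has_path_limit p v alpha g.
Proof.
elim=> {g} [P|b b1|a g _ h|g h _ hg _ hh|g h gh _ hg].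
- exact: (has_path_limit_horner p_prime HC).
- exact: (has_path_limit_pole p_prime HC).
- exact: (has_path_limitZ p_prime HC).
- exact: (has_path_limitD p_prime HC).
- exact: (eq_has_path_limit p_prime HC) hg.
Qed.

(** For a pole, [u / (b - u) = -1 + b / (b - u)]. The factor [u] comes from the weight [x - a] in
    the integral. *)
Lemma simple_mulX g : simple_fun g -> simple_fun (fun u => u * g u).
Proof.
elim=> {g} [P|b b1|a g _ h|g h _ hg _ hh|g h gh _ hg].
- apply: eq_simple (simple_horner ('X * P)) => u _.
  by rewrite hornerM hornerX.
- apply: eq_simple (simpleD (simple_horner (-1)%:P) (simpleZ b (simple_pole b1))).
  move=> u u1; have := disc_pole_neq0 b1 u1; rewrite hornerC => h.
  by field.
- by apply: eq_simple (simpleZ a h) => u _; rewrite mulrCA.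
- by apply: eq_simple (simpleD hg hh) => u _; rewrite mulrDr.
- by apply: eq_simple hg => u u1; rewrite gh.
Qed.

(** Partial fractions: subtracting [a * Q] with [a = P.[z] / Q.[z]] makes the numerator divisible by
    [X - z], which splits off the pole at [z]. *)
Lemma simple_quotient (s : seq C) (P : {poly C}) :
  uniq s -> (forall z, z \in s -> 1 <= v (z - 1)) ->
  simple_fun (fun u => P.[u] / \prod_(z <- s) (u - z)).
Proof.
elim: s P => [|z s IH] P /=.
  by move=> _ _; apply: eq_simple (simple_horner P) => u _; rewrite big_nil divr1.
move=> /andP[zs us] hs.
have hs' y : y \in s -> 1 <= v (y - 1) by move=> ys; apply: hs; rewrite inE ys orbT.
have z1 : 1 <= v (z - 1) by apply: hs; rewrite mem_head.
pose Q := \prod_(y <- s) ('X - y%:P).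
have QE u : Q.[u] = \prod_(y <- s) (u - y).
  by rewrite horner_prod; apply: eq_bigr => y _; rewrite hornerXsubC.
have Qz : Q.[z] != 0 by rewrite -/(root Q z) root_prod_XsubC.
pose a := P.[z] / Q.[z].
have [S hS] : exists S, P - a *: Q = S * ('X - z%:P).
  apply/factor_theorem; rewrite /root hornerD hornerN hornerZ.
  by rewrite /a mulfVK // subrr.
apply: eq_simple (simpleD (simpleZ (- a) (simple_pole z1)) (IH S us hs')) => u u1.
rewrite big_cons -!QE.
have uz := disc_pole_neq0 z1 u1.
have Qu : Q.[u] != 0.
  rewrite -/(root Q u) root_prod_XsubC; apply/negP => /hs'.
  by rewrite leNgt u1.
have PE : P.[u] = a * Q.[u] + S.[u] * (u - z).
  by rewrite -[P](subrK (a *: Q)) hS hornerD hornerM hornerXsubC hornerZ addrC.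
rewrite PE; have uz' : u - z != 0 by rewrite -opprB oppr_eq0.
by field; rewrite Qu uz' uz.
Qed.

(** The shift [p^k] is never 0 and eventually smaller than the distance from [b] to any other point
    of [s]. *)
Lemma eventually_notin (s : seq C) b :
  exists K, forall k, (K <= k)%N -> b + p%:R ^+ k \notin s.
Proof.
have vp0 : 0 <= v p%:R < 1 by rewrite (absval_ge0 Hv) vp.
elim: s => [|z s [K hK]]; first by exists 0.
have [<-|bz] := eqVneq b z.
  exists K => k /hK h; rewrite inE negb_or h andbT -subr_eq0 addrAC subrr add0r.
  by rewrite expf_neq0 // char0 -lt0n prime_gt0.
have d0 : 0 < v (z - b) by rewrite (absval_gt0 Hv) subr_eq0 eq_sym.
have [K' hK'] := exp_small vp0 d0.
exists (maxn K K') => k; rewrite geq_max => /andP[/hK h /hK' h'].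
rewrite inE negb_or h andbT; apply/eqP => e; move: h'.
by rewrite -e addrAC subrr add0r (absvalX Hv) ltxx.
Qed.

Lemma absval_prod_poles (s : seq C) u : v (u - 1) < 1 ->
  (forall z, z \in s -> 1 <= v (z - 1)) ->
  1 <= v (\prod_(z <- s) (u - z)).
Proof.
move=> u1; elim: s => [|z s IH] hs; first by rewrite big_nil (absval1 Hv).
rewrite big_cons (absvalM Hv) -[1]mulr1 ler_pM //.
  by rewrite (absval_distC Hv) disc_pole // hs // mem_head.
by apply: IH => y ys; apply: hs; rewrite inE ys orbT.
Qed.

(** Each pole is shifted by a high power of [p]. On the disc all factors have absolute value at
    least 1, so the inverses change little. *)
Lemma separate_poles (s : seq C) (e : R) : 0 < e ->
  (forall z, z \in s -> 1 <= v (z - 1)) ->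
  exists s' : seq C, [/\ uniq s', forall z, z \in s' -> 1 <= v (z - 1) &
    forall u, v (u - 1) < 1 ->
      v ((\prod_(z <- s') (u - z))^-1 - (\prod_(z <- s) (u - z))^-1) < e].
Proof.
move=> e0; elim: s => [|z s IH] hs.
  by exists [::]; split=> // u _; rewrite subrr (absval0 Hv).
have z1 : 1 <= v (z - 1) by apply: hs; rewrite mem_head.
have hs1 y : y \in s -> 1 <= v (y - 1) by move=> ys; apply: hs; rewrite inE ys orbT.
have [s' [us' hs' close]] := IH hs1.
have vp0 : 0 <= v p%:R < 1 by rewrite (absval_ge0 Hv) vp.
have [K hK] := eventually_notin s' z.
(* A shift below [e] gives the approximation; a shift below 1 keeps the pole outside the disc. *)
have m0 : 0 < Num.min e 1 by rewrite lt_min e0 ltr01.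
have [K' hK'] := exp_small vp0 m0.
pose k := maxn K K'; pose y := z + p%:R ^+ k.
have ys' : y \notin s' by apply: hK; rewrite leq_maxl.
have := hK' k (leq_maxr _ _); rewrite -(absvalX Hv) lt_min => /andP[ke k1].
have y1 : 1 <= v (y - 1).
  apply: (absval_ge1_perturb Hv) z1; rewrite /y.
  have -> : z - 1 - (z + p%:R ^+ k - 1) = - (p%:R ^+ k) by ring.
  by rewrite (absvalN Hv); exact: k1.
exists (y :: s'); split=> [|t|u u1]; first by rewrite /= ys'.
  by rewrite inE => /predU1P[->|/hs'].
rewrite !big_cons.
have hp := absval_prod_poles u1 hs1; have hp' := absval_prod_poles u1 hs'.
have uz : 1 <= v (u - z) by rewrite (absval_distC Hv) disc_pole.
have uy : 1 <= v (u - y) by rewrite (absval_distC Hv) disc_pole.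
have hc := close u u1.
move: hp hp' hc; set A := \prod_(_ <- s') _; set B := \prod_(_ <- s) _ => hp hp' hc.
have nz x : 1 <= v x -> x != 0.
  by move=> x1; rewrite -(absval_gt0 Hv) (lt_le_trans ltr01).
have inv1 x : 1 <= v x -> v x^-1 <= 1.
  by move=> x1; rewrite (absvalV Hv) invf_le1 // (lt_le_trans ltr01).
have -> : ((u - y) * A)^-1 - ((u - z) * B)^-1 =
    (u - z)^-1 * (A^-1 - B^-1) + (y - z) * ((u - y)^-1 * (u - z)^-1 * A^-1).
  by field; rewrite !nz.
apply: (absval_add_lt Hv).
  by rewrite (absvalM Hv); apply: le_lt_trans hc; rewrite ler_piMl ?(absval_ge0 Hv) ?inv1.
have -> : y - z = p%:R ^+ k by rewrite /y addrAC subrr add0r.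
rewrite (absvalM Hv); apply: le_lt_trans ke; rewrite ler_piMr ?(absval_ge0 Hv) //.
by rewrite !(absvalM Hv) !mulr_ile1 ?mulr_ge0 ?(absval_ge0 Hv) ?inv1.
Qed.

(** * Uniform limits of simple functions *)

Definition approximable (f : C -> C) : Prop := forall e : R, 0 < e ->
  exists2 g, simple_fun g & forall u, v (u - 1) < 1 -> v (g u - f u) < e.

Lemma rational_approximable (P Q : {poly C}) :
  (forall u, v (u - 1) < 1 -> Q.[u] != 0) ->
  approximable (fun u => P.[u] / Q.[u]).
Proof.
move=> Q0 e e0.
have [s hs] := poly_splits root_exists Q.
have c0 : lead_coef Q != 0.
  have : Q.[1] != 0 by apply: Q0; rewrite subrr (absval0 Hv).
  by apply: contraNneq => c0; rewrite hs c0 scale0r horner0.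
have QE u : Q.[u] = lead_coef Q * \prod_(y <- s) (u - y).
  rewrite {1}hs hornerZ horner_prod; congr (_ * _).
  by apply: eq_bigr => y _; rewrite hornerXsubC.
have s1 z : z \in s -> 1 <= v (z - 1).
  move=> zs; rewrite leNgt; apply/negP => /Q0 /negP; apply.
  by rewrite -/(root Q z) hs rootZ // root_prod_XsubC.
(* The leading coefficient of [Q] goes into the numerator, which is bounded by [M] on the disc;
   hence the tolerance [e / M] below. *)
pose P' := (lead_coef Q)^-1 *: P.
have [M M1 PM] := poly_coef_bounded Hv P'.
have M0 : 0 < M by apply: lt_le_trans M1.
have [s' [us' hs' close]] := separate_poles (divr_gt0 e0 M0) s1.
exists (fun u => P'.[u] / \prod_(z <- s') (u - z)); first exact: simple_quotient.
move=> u u1; have := close u u1; rewrite QE invfM.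
set A := \prod_(_ <- s') _; set B := \prod_(_ <- s) _ => h.
have -> : P'.[u] / A - P.[u] * ((lead_coef Q)^-1 / B) = P'.[u] * (A^-1 - B^-1).
  by rewrite /P' hornerZ; ring.
rewrite (absvalM Hv); move: h; rewrite ltr_pdivlMr // mulrC; apply: le_lt_trans.
rewrite ler_wpM2r ?(absval_ge0 Hv) //.
have := @absval_horner_le _ _ _ Hv P' u 1 M _ (lexx _) (disc_le1 u1) PM (leqnSn _).
by rewrite expr1n mulr1.
Qed.

Lemma approximable_mulX f : approximable f -> approximable (fun u => u * f u).
Proof.
move=> h e /h[g gs close]; exists (fun u => u * g u); first exact: simple_mulX.
move=> u u1; rewrite -mulrBr (absvalM Hv); apply: le_lt_trans (close u u1).
by rewrite ler_piMl ?(absval_ge0 Hv) // disc_le1.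
Qed.

Lemma bounded_seriesB f g c d B D :
  bounded_series v f c B -> bounded_series v g d D ->
  bounded_series v (fun u => f u - g u) (fun i => c i - d i) (Num.max B D).
Proof.
move=> fc gd.
have -> : (fun u => f u - g u) = (fun u => f u + -1 * g u).
  by apply/funext => u; rewrite mulN1r.
have -> : (fun i => c i - d i) = (fun i => c i + -1 * d i).
  by apply/funext => i; rewrite mulN1r.
apply: (bounded_seriesD HC).
  by apply: bounded_series_le fc; rewrite le_max lexx.
apply: bounded_series_le (bounded_seriesZ HC (-1) gd).
by rewrite (absvalN1 Hv) mul1r le_max lexx orbT.
Qed.

(** Cauchy's estimate replaces the crude coefficient bound of the difference by the uniform distance
    [e]. *)
Lemma bounded_series_dist f g c d B D e :
  bounded_series v f c B -> bounded_series v g d D -> 0 < e ->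
  (forall u, v (u - 1) < 1 -> v (f u - g u) <= e) ->
  bounded_series v (fun u => f u - g u) (fun i => c i - d i) e.
Proof.
move=> fc gd e0 close.
exact: (bounded_series_cauchy p_prime HC (bounded_seriesB fc gd) close e0).
Qed.

(** The bound does not depend on [n], so means along a whole path survive uniform limits. *)
Lemma unity_mean_dist f g c d B D e n :
  bounded_series v f c B -> bounded_series v g d D -> 0 < e ->
  (forall u, v (u - 1) < 1 -> v (f u - g u) <= e) ->
  v (unity_mean (p ^ n) f - unity_mean (p ^ n) g) <= e.
Proof.
move=> fc gd e0 close.
have := unity_mean_bounded_series p_prime HC n (bounded_series_dist fc gd e0 close).
rewrite (eq_unity_mean (h := fun u => f u + -1 * g u)); last first.
  by move=> x _; rewrite mulN1r.
by rewrite (unity_meanD char0 root_exists) // (unity_meanZ char0 root_exists) // mulN1r.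
Qed.

Lemma approximable_seq f : approximable f ->
  exists g : nat -> C -> C, (forall n, simple_fun (g n)) /\
    forall n u, v (u - 1) < 1 -> v (g n u - f u) < n.+1%:R^-1.
Proof.
move=> h; have /choice[g hg] : forall n : nat, exists g, simple_fun g /\
    forall u, v (u - 1) < 1 -> v (g u - f u) < n.+1%:R^-1.
  move=> n; have n0 : 0 < n.+1%:R^-1 :> R by rewrite invr_gt0 ltr0Sn.
  by have [g gs close] := h _ n0; exists g.
by exists g; split=> n; case: (hg n).
Qed.

Lemma approximable_seq_dist f (g : nat -> C -> C) m n N u :
  (forall n u, v (u - 1) < 1 -> v (g n u - f u) < n.+1%:R^-1) ->
  (N <= m)%N -> (N <= n)%N -> v (u - 1) < 1 -> v (g m u - g n u) <= N.+1%:R^-1.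
Proof.
move=> close Nm Nn u1.
have le k : (N <= k)%N -> v (g k u - f u) <= N.+1%:R^-1.
  move=> Nk; apply: (le_trans (ltW (close k u u1))).
  by rewrite lef_pV2 ?posrE ?ltr0Sn // ler_nat.
apply: (absval_dist_le Hv (y := f u)); first exact: le.
by rewrite (absval_distC Hv); apply: le.
Qed.

(** By Cauchy's estimate the coefficients of the approximants converge uniformly in the index; their
    limits are the coefficients of [f]. *)
Lemma approximable_bounded_series f : approximable f ->
  exists c B, bounded_series v f c B.
Proof.
move=> /approximable_seq[g [gs close]].
have /choice[c /choice[B hcB]] := fun n => simple_bounded_series (gs n).
have pos (N : nat) : 0 < N.+1%:R^-1 :> R by rewrite invr_gt0 ltr0Sn.
have dist N m n j : (N <= m)%N -> (N <= n)%N -> v (c m j - c n j) <= N.+1%:R^-1.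
  move=> Nm Nn; have [/(_ j)] := bounded_series_dist (hcB m) (hcB n) (pos N)
    (fun u => approximable_seq_dist close Nm Nn (u := u)).
  by [].
have /choice[d hd] : forall j, exists l, converges v (c ^~ j) l.
  move=> j; apply: (Cp_complete HC) => e e0.
  have [N hN] := invn_small e0; exists N => m n Nm Nn.
  exact: le_lt_trans (dist N m n j Nm Nn) (hN _ (leqnn _)).
have cd n j : v (d j - c n j) <= n.+1%:R^-1.
  by apply: (converges_le Hv (N := n)) (hd j) _ => m nm; apply: dist.
(* [d] stays within [1%:R^-1 = 1] of the coefficients [c 0], which are bounded by [B 0]. *)
exists d, (Num.max (B 0) 1); split=> [i|u u1].
  rewrite -[d i](subrK (c 0 i)); apply: (absval_add_le Hv); rewrite le_max.
    by apply/orP; right; rewrite (le_trans (cd 0 i)) ?invr1.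
  by case: (hcB 0) => ->.
move=> e e0; have [n /(_ n (leqnn n)) hn] := invn_small e0.
have [_ /(_ u u1 e e0) [K hK]] := hcB n.
exists K => k /hK hk.
(* Compare in turn with the partial sum of [c n], with [g n] and with [f]; the first bound is
   uniform in [k]. *)
apply: (absval_dist_lt Hv (y := psum (c n) k u)).
  rewrite /psum -sumrB; apply: le_lt_trans hn; apply: (absval_sum_le Hv) => [|i _].
    exact: ltW.
  rewrite -mulrBl (absvalM Hv) (absvalX Hv); apply: le_trans (cd n i).
  by rewrite ler_piMr ?exprn_ile1 ?(absval_ge0 Hv) // ltW.
apply: (absval_dist_lt Hv (y := g n u)) => //.
exact: lt_trans (close n u u1) hn.
Qed.

(** The limits [M n] for the simple approximants form a Cauchy sequence, because means stay as close
    as the functions. The step [l] may depend on [e], as the definition of the integral allows. *)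
Lemma approximable_path_limit alpha f : approximable f ->
  exists L, forall e : R, 0 < e -> exists2 l, (0 < l)%N &
    exists K, forall k, (K <= k)%N ->
      v (unity_mean (p ^ path_exp alpha l k) f - L) < e.
Proof.
move=> fa; have [cf [Bf hf]] := approximable_bounded_series fa.
have [g [gs close]] := approximable_seq fa.
have /choice[c /choice[B hcB]] := fun n => simple_bounded_series (gs n).
have /choice[l /choice[M hlM]] := fun n => simple_path_limit alpha (gs n).
have pos (N : nat) : 0 < N.+1%:R^-1 :> R by rewrite invr_gt0 ltr0Sn.
have dist N m n : (N <= m)%N -> (N <= n)%N -> v (M m - M n) <= N.+1%:R^-1.
  move=> Nm Nn; have [lm Mm] := hlM m; have [ln Mn] := hlM n.
  (* Both limits are taken along the common step [l m * l n]. *)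
  have := convergesD Hv (path_limit_mul ln Mm)
    (convergesZ Hv (-1) (path_limit_mul lm Mn)).
  rewrite (mulnC (l n)) mulN1r => h.
  apply: (converges_absval_le Hv (N := 0) h) => k _; rewrite mulN1r.
  apply: (unity_mean_dist _ (hcB m) (hcB n)) => // u u1.
  exact: approximable_seq_dist close Nm Nn u1.
have [L hL] : exists L, converges v M L.
  apply: (Cp_complete HC) => e e0.
  have [N hN] := invn_small e0; exists N => m n Nm Nn.
  exact: le_lt_trans (dist N m n Nm Nn) (hN _ (leqnn _)).
exists L => e e0; have [n /(_ n (leqnn n)) hn] := invn_small e0.
have [ln Mn] := hlM n; exists (l n) => //.
have [K hK] := Mn e e0; exists K => k /hK hk.
set N := path_exp _ _ _ in hk *.
apply: (absval_dist_lt Hv (y := unity_mean (p ^ N) (g n))).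
  apply: le_lt_trans hn; apply: (unity_mean_dist _ hf (hcB n)) => // u u1.
  by rewrite (absval_distC Hv) ltW // close.
apply: (absval_dist_lt Hv (y := M n)) => //.
apply: le_lt_trans hn; rewrite (absval_distC Hv).
by apply: (converges_le Hv (N := n)) hL _ => m nm; apply: dist.
Qed.

Lemma Krasner_approximable (a b : C) f : a != b ->
  Krasner_analytic v (Arc v a b) f -> approximable (fun u => f (a + (b - a) * u)).
Proof.
move=> ab [r [rr rf]] e e0.
have arc u : v (u - 1) < 1 -> Arc v a b (a + (b - a) * u).
  move=> u1; rewrite /Arc /=.
  have -> : a + (b - a) * u - b = (b - a) * (u - 1) by ring.
  rewrite (absvalM Hv) (absval_distC Hv b) gtr_pMr //.
  by rewrite (absval_gt0 Hv) subr_eq0.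
have [N /(_ N (leqnn N)) hN] := rf e e0.
have [P [Q PQ]] := rr N.
(* Composition with this affine polynomial keeps the approximants rational while moving the arc to
   the disc. *)
pose l : {poly C} := (b - a) *: 'X + a%:P.
have lE u : l.[u] = a + (b - a) * u.
  by rewrite hornerD hornerZ hornerX hornerC addrC.
have [u /arc/PQ[]||g gs close] := @rational_approximable (P \Po l) (Q \Po l) _ e.
- by rewrite horner_comp lE.
- exact: e0.
exists g => // u u1.
apply: (absval_dist_lt Hv (y := r N (a + (b - a) * u))); last exact/hN/arc.
have [_ ->] := PQ _ (arc u u1).
by have := close u u1; rewrite !horner_comp lE.
Qed.

End SimpleFunctions.

(** * Transfer from the unit disc back to the arc *)

Theorem theorem4p7 (R : realType) (p : nat) (p_prime : prime p) (p_odd : odd p)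
    (C : fieldType) (v : C -> R) (Cp : is_Cp p v)
    (a b : C) (ab : a != b) (alpha : int) :
  Krasner_analytic v (Arc v a b) `<=` path_integrable p v a b (Phi_ alpha).
Proof.
move=> f fK.
have HC := is_Cp_Cp_like p_prime Cp; have Hv := Cp_absval HC.
have fa := Krasner_approximable p_prime HC ab fK.
have ba : b - a != 0 by rewrite subr_eq0 eq_sym.
have vba : 0 < v (b - a) by rewrite (absval_gt0 Hv).
split.
  have [c [B [_ hc]]] := approximable_bounded_series p_prime HC fa.
  (* The coefficients are rescaled because [u - 1 = (x - b) / (b - a)]. *)
  exists (fun i => c i / (b - a) ^+ i) => x; rewrite /Arc /= => xA.
  pose u := (x - a) / (b - a).
  have xu : a + (b - a) * u = x by rewrite /u; field.
  have u1E : u - 1 = (x - b) / (b - a) by rewrite /u; field.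
  have u1 : v (u - 1) < 1.
    by rewrite u1E (absvalM Hv) (absvalV Hv) ltr_pdivrMr // mul1r (absval_distC Hv b).
  have := hc u u1; rewrite xu; congr (converges v _ _); apply/funext => n.
  rewrite /psum; apply: eq_bigr => i _.
  by rewrite u1E expr_div_n mulrA mulrAC.
have [L hL] := approximable_path_limit p_prime HC alpha (approximable_mulX HC fa).
(* As [x - a = (b - a) * u], the path mean is [b - a] times the mean of
   [u * f (a + (b - a) * u)]. *)
exists ((b - a) * L) => e e0.
have [l l0 [K hK]] := hL _ (divr_gt0 e0 vba).
have [phi [phiS phiV]] := Phi_ex alpha l0.
exists phi; first by exists l.
exists K => k sk Kk; have := hK k (ltnW Kk).
(* From [path_start phi] on, [alpha + l * k] is positive and the absolute value in [path_exp]
   changes nothing. *)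
have -> : path_exp alpha l k = phi k by rewrite /path_exp -phiV.
rewrite ltr_pdivlMr // mulrC -(absvalM Hv) mulrBr.
rewrite -(unity_meanZ (Cp_natr_eq0 HC) (Cp_root HC)) ?expn_gt0 ?prime_gt0 //.
congr (v (_ - _) < e); apply: eq_unity_mean => x _.
by rewrite /= [X in _ = X * _]addrAC subrr add0r mulrA.
Qed.
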